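(* Work in $\mathrm{ZFU}$. Assume that cardinality is parametrically representable. Then Plenitude$^+$ implies the Reflection Principle (RP).
   Context: $\mathrm{ZFU}$ is ZF set theory with urelements. Its language has $\in$ and a unary predicate $\mathscr{A}$ for urelements; $\mathscr{A}$ also denotes the class of all urelements. A set is an object that is not an urelement. The axioms are Foundation, Pairing, Union, Powerset, Infinity, the Separation schema, the Replacement schema (but not Collection), Extensionality for sets only, and the axiom that no urelement has members. The urelements may form a proper class. $x\sim y$ means there is a bijection between the sets $x$ and $y$. Plenitude$^+$: for every set $x$ there is a set $A$ of urelements with $x\sim A$. Cardinality is parametrically representable if there are a formula $\varphi$ and an object $p$ such that $\varphi(x,|x|,p)$ defines a class function $x\mapsto|x|$ on sets such that for all sets $x,y$: $x\sim y$ if and only if $|x|=|y|$, and moreover $x\sim|x|$ for every set $x$. RP (schema, for each formula $\varphi$): for every set $x$ there is a transitive set $t$ with $x\subseteq t$ such that for all $x_1,\dots,x_n\in t$, $\varphi(x_1,\dots,x_n)\leftrightarrow\varphi^t(x_1,\dots,x_n)$, where $\varphi^t$ is the relativization of $\varphi$ to $t$. *)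

(* Defs.v *)
(** Plain Rocq, no library: first-order logic over the language {∈, 𝒜} of set
    theory with urelements, with Tarskian semantics.  "Working in ZFU" is rendered as
    working in an arbitrary model of ZFU.  The axioms are written as first-order
    conditions on the model, and the schemas quantify over object-language
    formulas of type [formula]. *)

(** Variables are de Bruijn indices.  The primitive logical symbols are ¬, ∧, ∃;
    the remaining ones are the usual classical abbreviations. *)
Inductive formula : Type :=
| fMem (i j : nat)
| fEq (i j : nat)
| fUr (i : nat)
| fNot (phi : formula)
| fAnd (phi psi : formula)
| fEx (phi : formula).

Fixpoint free (i : nat) (phi : formula) : Prop :=
  match phi with
  | fMem j k | fEq j k => i = j \/ i = k
  | fUr j => i = j
  | fNot phi => free i phi
  | fAnd phi psi => free i phi \/ free i psi
  | fEx phi => free (S i) phi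
  end.

(** [shift k] renames variables so as to make room for a new variable [k]. *)
Fixpoint shift (k i : nat) : nat :=
  match k, i with
  | 0, _ => S i
  | S _, 0 => 0
  | S k, S i => S (shift k i)
  end.

(** [relativize k phi] is phi^t, where t is the variable [k], which is new: the
    variables [i >= k] of [phi] are renamed to [S i]. *)
Fixpoint relativize (k : nat) (phi : formula) : formula :=
  match phi with
  | fMem i j => fMem (shift k i) (shift k j)
  | fEq i j => fEq (shift k i) (shift k j)
  | fUr i => fUr (shift k i)
  | fNot phi => fNot (relativize k phi)
  | fAnd phi psi => fAnd (relativize k phi) (relativize k psi)
  | fEx phi => fEx (fAnd (fMem 0 (S k)) (relativize (S k) phi))
  end.

Record structure : Type := Structure {
  carrier :> Type;
  mem : carrier -> carrier -> Prop;
  ur : carrier -> Prop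
}.

Arguments mem {s} _ _.
Arguments ur {s} _.

Notation "x ∈ y" := (mem x y) (at level 70, no associativity).

Definition scons {T : Type} (a : T) (rho : nat -> T) (i : nat) : T :=
  match i with 0 => a | S i => rho i end.

Fixpoint sat {M : structure} (rho : nat -> M) (phi : formula) : Prop :=
  match phi with
  | fMem i j => rho i ∈ rho j
  | fEq i j => rho i = rho j
  | fUr i => ur (rho i)
  | fNot phi => ~ sat rho phi
  | fAnd phi psi => sat rho phi /\ sat rho psi
  | fEx phi => exists a : M, sat (scons a rho) phi
  end.

Section InStructure.
Variable M : structure.
Implicit Types (a b c f p t u v w x y z A : M) (rho : nat -> M).

Definition is_set x : Prop := ~ ur x.

Definition subset x y : Prop := forall z, z ∈ x -> z ∈ y.

Definition transitive_set t : Prop :=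
  is_set t /\ forall y, y ∈ t -> subset y t.

(** [u] is the set {a, b}. *)
Definition is_upair u a b : Prop :=
  is_set u /\ forall z, z ∈ u <-> z = a \/ z = b.

(** [u] is the Kuratowski pair {{a}, {a, b}}. *)
Definition is_opair u a b : Prop :=
  exists v w, is_upair v a a /\ is_upair w a b /\ is_upair u v w.

Definition maps f a b : Prop := exists u, is_opair u a b /\ u ∈ f.

Definition bijection f x y : Prop :=
  is_set f
  /\ (forall u, u ∈ f -> exists a b, a ∈ x /\ b ∈ y /\ is_opair u a b)
  /\ (forall a, a ∈ x -> exists! b, maps f a b)
  /\ (forall b, b ∈ y -> exists! a, maps f a b).

Definition equinumerous x y : Prop :=
  is_set x /\ is_set y /\ exists f, bijection f x y.

Definition urelements_have_no_members : Prop := forall x y, ur x -> ~ y ∈ x.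

Definition extensionality : Prop :=
  forall x y, is_set x -> is_set y -> (forall z, z ∈ x <-> z ∈ y) -> x = y.

Definition foundation : Prop :=
  forall x, is_set x -> (exists y, y ∈ x) ->
  exists y, y ∈ x /\ forall z, z ∈ x -> ~ z ∈ y.

Definition pairing : Prop := forall a b, exists u, is_upair u a b.

Definition union : Prop :=
  forall x, is_set x ->
  exists u, is_set u /\ forall z, z ∈ u <-> exists y, y ∈ x /\ z ∈ y.

(** The condition [is_set z] matters: every urelement is vacuously [subset] of [x]. *)
Definition powerset : Prop :=
  forall x, is_set x ->
  exists u, is_set u /\ forall z, z ∈ u <-> is_set z /\ subset z x.

(** Some set contains ∅ and is closed under y ↦ y ∪ {y}, for sets y. *)
Definition infinity : Prop :=
  exists w, is_set w
  /\ (exists e, e ∈ w /\ is_set e /\ forall z, ~ z ∈ e)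
  /\ (forall y, y ∈ w -> is_set y ->
      exists s, s ∈ w /\ is_set s /\ forall z, z ∈ s <-> z ∈ y \/ z = y).

(** In the two schemas the parameters are given by [rho]. *)
Definition separation (phi : formula) : Prop :=
  forall rho x, is_set x ->
  exists y, is_set y /\ forall z, z ∈ y <-> z ∈ x /\ sat (scons z rho) phi.

Definition replacement (phi : formula) : Prop :=
  forall rho w, is_set w ->
  (forall x, x ∈ w -> exists! y, sat (scons x (scons y rho)) phi) ->
  exists v, is_set v
  /\ forall y, y ∈ v <-> exists x, x ∈ w /\ sat (scons x (scons y rho)) phi.

Record ZFU : Prop := {
  ZFU_urelements : urelements_have_no_members;
  ZFU_extensionality : extensionality;
  ZFU_foundation : foundation;
  ZFU_pairing : pairing;
  ZFU_union : union;
  ZFU_powerset : powerset;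
  ZFU_infinity : infinity;
  ZFU_separation : forall phi, separation phi;
  ZFU_replacement : forall phi, replacement phi
}.

Definition plenitude_plus : Prop :=
  forall x, is_set x ->
  exists A, is_set A /\ (forall a, a ∈ A -> ur a) /\ equinumerous x A.

(** phi(x, c, p), "c = |x|".  Variables 0 and 1 are x and c; all others denote p, so
    that x, c and p are the only objects on which the truth value depends. *)
Definition card_graph (phi : formula) p x c : Prop :=
  sat (scons x (scons c (fun _ => p))) phi.

Definition cardinality_parametrically_representable : Prop :=
  exists (phi : formula) p,
  (forall x, is_set x -> exists! c, card_graph phi p x c)
  /\ (forall x y c d, is_set x -> is_set y ->
      card_graph phi p x c -> card_graph phi p y d ->
      (equinumerous x y <-> c = d))
  /\ (forall x c, is_set x -> card_graph phi p x c -> equinumerous x c).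

(** Only the values of the free variables of [phi] are required to be in [t], so
    that for a sentence [phi] the empty set [t] is not a vacuous witness. *)
Definition reflects t (phi : formula) : Prop :=
  forall rho, (forall i, free i phi -> rho i ∈ t) ->
  (sat rho phi <-> sat (scons t rho) (relativize 0 phi)).

Definition reflection_principle : Prop :=
  forall (phi : formula) x, is_set x ->
  exists t, transitive_set t /\ subset x t /\ reflects t phi.

End InStructure.

(* Main.v *)
Require Import Defs.
From Stdlib Require Import ClassicalEpsilon FunctionalExtensionality Lia.

(** The usual proof of reflection builds t as the union of a chain of sets, each of which
    contains witnesses for the parameters from the previous one.  When the urelements form
    a proper class, the universe is not the union of an increasing chain of sets given by
    a definable function, and without the axiom of choice neither the witnesses nor larger
    and larger sets of urelements can be chosen.  Homogeneity replaces these choices: a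
    permutation of a set of urelements extends to an automorphism of the universe
    ([permute_automorphism]), so that what matters about the urelements of a witness is how
    many they are, and not which.

    Let p be the parameter of the cardinality function.  Every cardinal |x| is fixed by
    the automorphisms that fix p, and as there are always unused urelements this forces
    the support of |x|, the set of urelements in its transitive closure, into the support
    of p ([equinumerous_supported]).  Let K consist of the urelements in the support of p
    or of the set x that the reflecting set is to include.  Then every set is
    equinumerous to a set with support in K, and these are stratified by rank into the sets
    [stage K a].  So the number of urelements of a witness outside a given set can be
    bounded by a rank, and bounds on ranks can be collected by Replacement, because there is
    a least rank ([rank_bounding]).

    This yields a relation between ranks [a] and [b]: if E is a copy of [stage K a] that
    consists of urelements outside K, then parameters of rank at most [a] and support in
    K ∪ E have witnesses of rank at most [b], with at most [b] further urelements
    ([absorbs]).  All such copies E are conjugate over K ([aut_move]), so the relation does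
    not depend on E.  Let L be a set of ranks closed under it ([closed_chain]), and F an
    injection of [stage K L] into the urelements outside K, which exists by Plenitude
    ([fresh_copy]).  This single choice provides compatible copies F[stage K a] for
    all [a] in L, hence an increasing family of layers: the objects of rank at most [a]
    with support in K ∪ F[stage K a].  A witness for parameters in one layer can be moved
    into a later layer by an automorphism that fixes these parameters
    ([bounded_witness_moves]), so the union of the layers passes the Tarski-Vaught test
    ([reflects_of_witnesses]).

    Induction and recursion in the model apply to definable classes only.  Definability is
    therefore treated as a property of semantic predicates ([Def]), closed under the logical
    operations and under definable terms. *)

(** * Satisfaction, renaming and automorphisms *)

Definition tail {T : Type} (e : nat -> T) (i : nat) : T := e (S i).

Definition up (r : nat -> nat) (i : nat) : nat :=
  match i with 0 => 0 | S i => S (r i) end.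

Fixpoint rename (r : nat -> nat) (phi : formula) : formula :=
  match phi with
  | fMem i j => fMem (r i) (r j)
  | fEq i j => fEq (r i) (r j)
  | fUr i => fUr (r i)
  | fNot phi => fNot (rename r phi)
  | fAnd phi psi => fAnd (rename r phi) (rename r psi)
  | fEx phi => fEx (rename (up r) phi)
  end.

Lemma sat_free_ext (M : structure) phi : forall rho rho' : nat -> M,
  (forall i, free i phi -> rho i = rho' i) -> (sat rho phi <-> sat rho' phi).
Proof.
  induction phi as [i j | i j | i | phi IH | phi1 IH1 phi2 IH2 | phi IH];
    cbn; intros rho rho' H.
  - now rewrite (H i), (H j) by auto.
  - now rewrite (H i), (H j) by auto.
  - now rewrite (H i) by auto.
  - rewrite (IH rho rho' H). reflexivity.
  - rewrite (IH1 rho rho'), (IH2 rho rho') by auto. reflexivity.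
  - enough (E : forall a, sat (scons a rho) phi <-> sat (scons a rho') phi)
      by (split; intros [a Ha]; exists a; now apply E).
    intros a. apply IH. intros [|i] Hi; cbn; auto.
Qed.

Lemma sat_ext (M : structure) phi (rho rho' : nat -> M) :
  (forall i, rho i = rho' i) -> (sat rho phi <-> sat rho' phi).
Proof. intros H. apply sat_free_ext. auto. Qed.

Lemma sat_rename (M : structure) phi : forall r (rho : nat -> M),
  sat rho (rename r phi) <-> sat (fun i => rho (r i)) phi.
Proof.
  induction phi as [i j | i j | i | phi IH | phi1 IH1 phi2 IH2 | phi IH];
    cbn; intros r rho; try reflexivity.
  - rewrite IH. reflexivity.
  - rewrite IH1, IH2. reflexivity.
  - enough (E : forall a, sat (scons a rho) (rename (up r) phi)
                      <-> sat (scons a (fun i => rho (r i))) phi)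
      by (split; intros [a Ha]; exists a; now apply E).
    intros a. rewrite IH. apply sat_ext. now intros [|i].
Qed.

Lemma sat_automorphism (M : structure) (f : M -> M) :
  (forall y, exists x, f x = y) -> (forall x y, f x = f y -> x = y) ->
  (forall x y, f x ∈ f y <-> x ∈ y) -> (forall x, ur (f x) <-> ur x) ->
  forall phi rho, sat (fun i => f (rho i)) phi <-> sat rho phi.
Proof.
  intros Hsurj Hinj Hmem Hur phi.
  induction phi as [i j | i j | i | phi IH | phi1 IH1 phi2 IH2 | phi IH];
    cbn; intros rho; auto.
  - split; [apply Hinj | intros E; now rewrite E].
  - rewrite IH. reflexivity.
  - rewrite IH1, IH2. reflexivity.
  - assert (E : forall a, sat (scons (f a) (fun i => f (rho i))) phi
                      <-> sat (scons a rho) phi)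
      by (intros a; rewrite <- (IH (scons a rho)); apply sat_ext; now intros [|i]).
    split; intros [a Ha].
    + destruct (Hsurj a) as [b <-]. exists b. now apply E.
    + exists (f a). now apply E.
Qed.

(** * Definability with parameters from a class *)

Section Definability.
Context {M : structure}.
Implicit Types (C : M -> Prop) (e : nat -> M).

Definition any (x : M) : Prop := True.

Definition assign (s : nat -> nat + M) e (i : nat) : M :=
  match s i with inl j => e j | inr m => m end.

(** [s] tells the variables that stand for arguments of [F] ([inl]) from those that stand
    for parameters ([inr]).  The class [C] of the parameters is recorded because [F] is
    invariant under the automorphisms that fix its parameters. *)
Definition Def C (F : (nat -> M) -> Prop) : Prop :=
  exists phi s, (forall i m, s i = inr m -> C m)
  /\ forall e, F e <-> sat (assign s e) phi.

Definition DefT C (t : (nat -> M) -> M) : Prop := Def C (fun e => e 0 = t (tail e)).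

Definition Def1 C (P : M -> Prop) := Def C (fun e => P (e 0)).
Definition Def2 C (P : M -> M -> Prop) := Def C (fun e => P (e 0) (e 1)).
Definition Def3 C (P : M -> M -> M -> Prop) := Def C (fun e => P (e 0) (e 1) (e 2)).
Definition Def4 C (P : M -> M -> M -> M -> Prop) :=
  Def C (fun e => P (e 0) (e 1) (e 2) (e 3)).
Definition Fun1 C (f : M -> M) := DefT C (fun e => f (e 0)).
Definition Fun2 C (f : M -> M -> M) := DefT C (fun e => f (e 0) (e 1)).
Definition Fun3 C (f : M -> M -> M -> M) := DefT C (fun e => f (e 0) (e 1) (e 2)).

Lemma Def_iff C F G : (forall e, F e <-> G e) -> Def C F -> Def C G.
Proof.
  intros E (phi & s & Hs & H). exists phi, s. split; [exact Hs|].
  intros e. now rewrite <- E.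
Qed.

Lemma Def_weaken C F : Def C F -> Def any F.
Proof. intros (phi & s & Hs & H). exists phi, s. split; [now intros|auto]. Qed.

Lemma Def_ren C F (r : nat -> nat) : Def C F -> Def C (fun e => F (fun i => e (r i))).
Proof.
  intros (phi & s & Hs & H).
  exists phi, (fun i => match s i with inl j => inl (r j) | inr m => inr m end).
  split.
  - intros i m. destruct (s i) eqn:E; [discriminate|]. injection 1 as <-. eauto.
  - intros e. rewrite H. apply sat_ext. intros i. unfold assign. now destruct (s i).
Qed.

Lemma Def_not C F : Def C F -> Def C (fun e => ~ F e).
Proof.
  intros (phi & s & Hs & H). exists (fNot phi), s. split; [exact Hs|].
  intros e. cbn. now rewrite H.
Qed.

Lemma Def_and C F G : Def C F -> Def C G -> Def C (fun e => F e /\ G e).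
Proof.
  intros (phi & s & Hs & H) (psi & s' & Hs' & H').
  (* The variables of the two formulas are kept apart by their parity. *)
  exists (fAnd (rename (fun i => 2 * i) phi) (rename (fun i => S (2 * i)) psi)).
  exists (fun i => if Nat.even i then s (Nat.div2 i) else s' (Nat.div2 i)).
  split; [intros i m; destruct (Nat.even i); eauto|].
  intros e. cbn [sat]. rewrite !sat_rename, H, H'.
  enough (E : forall i,
    assign s e i = assign (fun i => if Nat.even i then s (Nat.div2 i)
                                    else s' (Nat.div2 i)) e (2 * i)
    /\ assign s' e i = assign (fun i => if Nat.even i then s (Nat.div2 i)
                                    else s' (Nat.div2 i)) e (S (2 * i))).
  { rewrite (sat_ext M phi _ _ (fun i => proj1 (E i))).
    rewrite (sat_ext M psi _ _ (fun i => proj2 (E i))). reflexivity. }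
  intros i. unfold assign.
  rewrite PeanoNat.Nat.even_succ, PeanoNat.Nat.even_even.
  rewrite PeanoNat.Nat.odd_even, PeanoNat.Nat.div2_succ_double.
  rewrite PeanoNat.Nat.div2_double. auto.
Qed.

Lemma Def_ex C (Q : M -> (nat -> M) -> Prop) :
  Def C (fun e => Q (e 0) (tail e)) -> Def C (fun e => exists a, Q a e).
Proof.
  intros (phi & s & Hs & H).
  exists (fEx (rename (fun i => match s i with inl 0 => 0 | _ => S i end) phi)).
  exists (fun i => match s i with inl (S j) => inl j | x => x end). split.
  - intros i m. destruct (s i) as [[|j]|] eqn:E; try discriminate.
    injection 1 as <-. eauto.
  - intros e. cbn [sat].
    enough (E : forall a, Q a e <->
      sat (scons a (assign (fun i => match s i with inl (S j) => inl j | x => x end) e))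
        (rename (fun i => match s i with inl 0 => 0 | _ => S i end) phi))
      by (split; intros [a Ha]; exists a; now apply E).
    intros a. rewrite (H (scons a e)), sat_rename. apply sat_ext.
    intros i. unfold assign. destruct (s i) as [[|j]|] eqn:E; cbn;
      rewrite ?E; reflexivity.
Qed.

Lemma Def_or C F G : Def C F -> Def C G -> Def C (fun e => F e \/ G e).
Proof.
  intros H H'. refine (Def_iff C _ _ _ (Def_not C _ (Def_and C _ _
    (Def_not C _ H) (Def_not C _ H')))).
  intros e. cbn. destruct (classic (F e)), (classic (G e)); tauto.
Qed.

Lemma Def_imp C F G : Def C F -> Def C G -> Def C (fun e => F e -> G e).
Proof.
  intros H H'. refine (Def_iff C _ _ _ (Def_or C _ _ (Def_not C _ H) H')).
  intros e. cbn. destruct (classic (F e)); tauto.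
Qed.

Lemma Def_equiv C F G : Def C F -> Def C G -> Def C (fun e => F e <-> G e).
Proof. intros H H'. apply Def_and; now apply Def_imp. Qed.

Lemma Def_all C (Q : M -> (nat -> M) -> Prop) :
  Def C (fun e => Q (e 0) (tail e)) -> Def C (fun e => forall a, Q a e).
Proof.
  intros H. refine (Def_iff C _ _ _ (Def_not C _ (Def_ex C
    (fun a e => ~ Q a e) (Def_not C _ H)))).
  intros e. split; [intros N a; apply NNPP; eauto | intros N [a Ha]; auto].
Qed.

Lemma Def_const C (P : Prop) : Def C (fun _ => P).
Proof.
  assert (T : Def C (fun _ => True)).
  { exists (fEx (fEq 0 0)), inl. split; [discriminate|].
    intros e. split; [intros _; now exists (e 0) | auto]. }
  destruct (classic P).
  - refine (Def_iff C _ _ _ T). tauto.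
  - refine (Def_iff C _ _ _ (Def_not C _ T)). tauto.
Qed.

Lemma Def2_mem C : Def2 C (@mem M).
Proof. exists (fMem 0 1), inl. split; [discriminate|]. intros e. reflexivity. Qed.

Lemma Def2_eq C : Def2 C (@eq M).
Proof. exists (fEq 0 1), inl. split; [discriminate|]. intros e. reflexivity. Qed.

Lemma Def1_ur C : Def1 C (@ur M).
Proof. exists (fUr 0), inl. split; [discriminate|]. intros e. reflexivity. Qed.

Lemma DefT_var C i : DefT C (fun e => e i).
Proof. exact (Def_ren C _ (fun k => match k with 0 => 0 | _ => S i end) (Def2_eq C)). Qed.

Lemma DefT_const C c : C c -> DefT C (fun _ => c).
Proof.
  intros Hc. exists (fEq 0 1), (fun i => match i with 0 => inl 0 | _ => inr c end).
  split; [|intros e; reflexivity].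
  intros [|i] m; [discriminate|]. now injection 1 as <-.
Qed.

Lemma DefT_tail C t : DefT C t -> DefT C (fun e => t (tail e)).
Proof.
  exact (Def_ren C _ (fun k => match k with 0 => 0 | S k => S (S k) end)).
Qed.

Lemma Def1_app C P a : Def1 C P -> DefT C a -> Def C (fun e => P (a e)).
Proof.
  intros HP Ha. apply Def_iff with (fun e => exists x, x = a e /\ P x).
  { intros e. split; [now intros (x & -> & H) | eauto]. }
  apply Def_ex, Def_and; assumption.
Qed.

Lemma Def2_app C P a b : Def2 C P -> DefT C a -> DefT C b ->
  Def C (fun e => P (a e) (b e)).
Proof.
  intros HP Ha Hb. apply Def_iff with (fun e => exists x, x = a e /\ P x (b e)).
  { intros e. split; [now intros (x & -> & H) | eauto]. }
  apply Def_ex, Def_and; [assumption|].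
  apply Def_iff with (fun e => exists y, y = b (tail e) /\ P (e 0) y).
  { intros e. split; [now intros (x & -> & H) | eauto]. }
  apply (Def_ex C (fun y e => _ /\ P (e 0) y)), Def_and; [now apply DefT_tail|].
  exact (Def_ren C _ (fun k => match k with 0 => 1 | _ => 0 end) HP).
Qed.

(** Infinitely many terms may be substituted, since only finitely many occur. *)
Lemma Def_sat C phi : forall s : nat -> (nat -> M) -> M, (forall i, DefT C (s i)) ->
  Def C (fun e => sat (fun i => s i e) phi).
Proof.
  induction phi as [i j | i j | i | phi IH | phi1 IH1 phi2 IH2 | phi IH];
    cbn; intros s Hs.
  - now apply (Def2_app C mem); [apply Def2_mem|..].
  - now apply (Def2_app C eq); [apply Def2_eq|..].
  - now apply (Def1_app C ur); [apply Def1_ur|..].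
  - now apply Def_not, IH.
  - now apply Def_and; [apply IH1 | apply IH2].
  - apply Def_ex. refine (Def_iff C _ _ _ (IH (fun i =>
      match i with 0 => fun e => e 0 | S i => fun e => s i (tail e) end) _)).
    + intros e. apply sat_ext. now intros [|i].
    + intros [|i]; [apply DefT_var | apply DefT_tail, Hs].
Qed.

Lemma Def_comp C F (s : nat -> (nat -> M) -> M) :
  Def C F -> (forall i, DefT C (s i)) -> Def C (fun e => F (fun i => s i e)).
Proof.
  intros (phi & s0 & Hs0 & H) Hs.
  refine (Def_iff C _ _ _ (Def_sat C phi (fun i =>
    match s0 i with inl j => s j | inr m => fun _ => m end) _)).
  - intros e. rewrite H. apply sat_ext. intros i. unfold assign. now destruct (s0 i).
  - intros i. destruct (s0 i) eqn:E; [apply Hs | apply DefT_const; eauto].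
Qed.

Lemma Def3_app C P a b c : Def3 C P -> DefT C a -> DefT C b -> DefT C c ->
  Def C (fun e => P (a e) (b e) (c e)).
Proof.
  intros HP Ha Hb Hc.
  apply (Def_comp C _ (fun i => match i with 0 => a | 1 => b | _ => c end) HP).
  now intros [|[|i]].
Qed.

Lemma Def4_app C P a b c d : Def4 C P -> DefT C a -> DefT C b -> DefT C c -> DefT C d ->
  Def C (fun e => P (a e) (b e) (c e) (d e)).
Proof.
  intros HP Ha Hb Hc Hd.
  apply (Def_comp C _ (fun i => match i with 0 => a | 1 => b | 2 => c | _ => d end) HP).
  now intros [|[|[|i]]].
Qed.

Lemma DefT_comp C t (s : nat -> (nat -> M) -> M) :
  DefT C t -> (forall i, DefT C (s i)) -> DefT C (fun e => t (fun i => s i e)).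
Proof.
  intros Ht Hs.
  apply (Def_comp C _ (fun i => match i with 0 => fun e => e 0
                                | S i => fun e => s i (tail e) end) Ht).
  intros [|i]; [apply DefT_var | apply DefT_tail, Hs].
Qed.

Lemma Fun1_app C f a : Fun1 C f -> DefT C a -> DefT C (fun e => f (a e)).
Proof. intros Hf Ha. now apply (DefT_comp C _ (fun _ => a) Hf). Qed.

Lemma Fun2_app C f a b : Fun2 C f -> DefT C a -> DefT C b ->
  DefT C (fun e => f (a e) (b e)).
Proof.
  intros Hf Ha Hb.
  apply (DefT_comp C _ (fun i => match i with 0 => a | _ => b end) Hf).
  now intros [|i].
Qed.

Lemma Fun3_app C f a b c : Fun3 C f -> DefT C a -> DefT C b -> DefT C c ->
  DefT C (fun e => f (a e) (b e) (c e)).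
Proof.
  intros Hf Ha Hb Hc.
  apply (DefT_comp C _ (fun i => match i with 0 => a | 1 => b | _ => c end) Hf).
  now intros [|[|i]].
Qed.

Lemma Def_equivariant C F f :
  (forall phi rho, sat (fun i => f (rho i)) phi <-> sat rho phi) ->
  (forall c, C c -> f c = c) -> Def C F -> forall e, F (fun i => f (e i)) <-> F e.
Proof.
  intros Hf HC (phi & s & Hs & H) e. rewrite !H, <- (Hf phi (assign s e)). apply sat_ext.
  intros i. unfold assign. destruct (s i) eqn:E; [reflexivity|].
  symmetry. eauto.
Qed.

Lemma DefT_equivariant C t f :
  (forall phi rho, sat (fun i => f (rho i)) phi <-> sat rho phi) ->
  (forall c, C c -> f c = c) -> DefT C t -> forall e, t (fun i => f (e i)) = f (t e).
Proof.
  intros Hf HC Ht e. symmetry.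
  now apply (Def_equivariant C _ f Hf HC Ht (scons (t e) e)).
Qed.

End Definability.

Create HintDb def.
#[export] Hint Resolve Def2_mem Def2_eq Def1_ur : def.

Ltac def_leaf :=
  first [ assumption | solve [auto with def nocore]
        | match goal with H : _ |- _ => exact (Def_weaken _ _ H) end ].

Ltac def_rel :=
  match goal with
  | |- Def ?C (fun e => ?R (@?a e) (@?b e) (@?c e) (@?d e)) =>
      apply (Def4_app C R a b c d); [def_leaf|..]
  | |- Def ?C (fun e => ?R (@?a e) (@?b e) (@?c e)) =>
      apply (Def3_app C R a b c); [def_leaf|..]
  | |- Def ?C (fun e => ?R (@?a e) (@?b e)) => apply (Def2_app C R a b); [def_leaf|..]
  | |- Def ?C (fun e => ?R (@?a e)) => apply (Def1_app C R a); [def_leaf|]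
  end.

Ltac def_term :=
  match goal with
  | |- DefT ?C (fun e => ?f (@?a e) (@?b e) (@?c e)) =>
      apply (Fun3_app C f a b c); [def_leaf|..]
  | |- DefT ?C (fun e => ?f (@?a e) (@?b e)) => apply (Fun2_app C f a b); [def_leaf|..]
  | |- DefT ?C (fun e => ?f (@?a e)) => apply (Fun1_app C f a); [def_leaf|]
  end.

(** Proves definability by recursion on the shape of the predicate.  The basic relations
    and functions are in the hint database or among the hypotheses. *)
Ltac def_go :=
  cbv beta delta [tail];
  lazymatch goal with
  | |- Def _ (fun _ => ?P) => apply Def_const
  | |- Def ?C (fun e => exists a, @?Q e a) =>
      apply (Def_ex C (fun a e => Q e a)); def_go
  | |- Def ?C (fun e => @?P e <-> @?Q e) => apply (Def_equiv C P Q); def_go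
  | |- Def ?C (fun e => ~ @?P e) => apply (Def_not C P); def_go
  | |- Def ?C (fun e => @?P e /\ @?Q e) => apply (Def_and C P Q); def_go
  | |- Def ?C (fun e => @?P e \/ @?Q e) => apply (Def_or C P Q); def_go
  | |- Def ?C (fun e => @?P e -> @?Q e) => apply (Def_imp C P Q); def_go
  | |- Def ?C (fun e => forall a, @?Q e a) =>
      apply (Def_all C (fun a e => Q e a)); def_go
  | |- Def _ _ => def_rel; def_go
  | |- DefT _ (fun e => e _) => apply DefT_var
  | |- DefT _ (fun _ => ?c) => apply DefT_const; first [exact I | assumption | idtac]
  | |- DefT _ _ => def_term; def_go
  end.

Ltac def := unfold Def1, Def2, Def3, Def4, Fun1, Fun2, Fun3; def_go.

(** * Sets defined by a condition *)

Section SetTheory.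
Context {M : structure} (hZFU : ZFU M).
Implicit Types (C Q : M -> Prop) (x y z u v w a b p A B K : M).

Local Arguments is_set {M} _.
Local Arguments subset {M} _ _.
Local Arguments transitive_set {M} _.
Local Arguments is_upair {M} _ _ _.
Local Arguments is_opair {M} _ _ _.
Local Arguments maps {M} _ _ _.
Local Arguments bijection {M} _ _ _.
Local Arguments equinumerous {M} _ _.

Lemma set_ext x y : is_set x -> is_set y -> (forall z, z ∈ x <-> z ∈ y) -> x = y.
Proof. apply (ZFU_extensionality _ hZFU). Qed.

Lemma ur_no_mem x y : ur x -> ~ y ∈ x.
Proof. apply (ZFU_urelements _ hZFU). Qed.

Definition is_empty v : Prop := is_set v /\ forall z, ~ z ∈ v.

Lemma exists_empty : exists v, is_empty v.
Proof. destruct (ZFU_infinity _ hZFU) as (w & _ & (e & _ & He) & _). now exists e. Qed.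

Definition the_or_empty Q v : Prop :=
  (Q v /\ forall y, Q y -> y = v)
  \/ (~ (exists u, Q u /\ forall y, Q y -> y = u)) /\ is_empty v.

Lemma the_or_empty_ex Q : exists v, the_or_empty Q v.
Proof.
  destruct (classic (exists u, Q u /\ forall y, Q y -> y = u)) as [[u H]|H].
  - exists u. now left.
  - destruct exists_empty as [e He]. exists e. now right.
Qed.

(** The default value is the empty set because that is definable without parameters:
    a description has no parameters beyond those of the condition. *)
Definition iota Q : M := proj1_sig (constructive_indefinite_description _ (the_or_empty_ex Q)).

Lemma iota_or_empty Q : the_or_empty Q (iota Q).
Proof. exact (proj2_sig (constructive_indefinite_description _ (the_or_empty_ex Q))). Qed.

Lemma iota_spec Q : (exists v, Q v) -> (forall u v, Q u -> Q v -> u = v) -> Q (iota Q).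
Proof.
  intros [v Hv] HQ. destruct (iota_or_empty Q) as [[H _]|[H _]]; [exact H|].
  destruct H. exists v. auto.
Qed.

Lemma iota_eq Q v : Q v -> (forall y, Q y -> y = v) -> iota Q = v.
Proof. intros Hv H. apply H, iota_spec; [eauto|]. intros a b Ha Hb. now rewrite (H a), (H b). Qed.

Lemma the_or_empty_unique Q u v : the_or_empty Q u -> the_or_empty Q v -> u = v.
Proof.
  intros [[Hu Hu']|[Hu [Hu1 Hu2]]] [[Hv Hv']|[Hv [Hv1 Hv2]]].
  - auto.
  - destruct Hv. eauto.
  - destruct Hu. eauto.
  - apply set_ext; auto. intros z. split; intros H; [destruct (Hu2 z)|destruct (Hv2 z)]; auto.
Qed.

Lemma Def1_is_set C : Def1 C is_set.
Proof. unfold is_set. def. Qed.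

Lemma Def2_subset C : Def2 C subset.
Proof. unfold subset. def. Qed.

Lemma DefT_iota C (Q : M -> (nat -> M) -> Prop) :
  Def C (fun e => Q (e 0) (tail e)) -> DefT C (fun e => iota (fun v => Q v e)).
Proof.
  intros H. apply Def_iff with (fun e => the_or_empty (fun v => Q v (tail e)) (e 0)).
  { intros e. split.
    - intros He. eapply the_or_empty_unique; [exact He | apply iota_or_empty].
    - intros ->. apply iota_or_empty. }
  assert (H1 : Def C (fun e => Q (e 0) (tail (tail e))))
    by exact (Def_ren C _ (fun k => match k with 0 => 0 | S k => S (S k) end) H).
  assert (H2 : Def C (fun e => Q (e 0) (tail (tail (tail e)))))
    by exact (Def_ren C _ (fun k => match k with 0 => 0 | S k => S (S (S k)) end) H).
  unfold the_or_empty, is_empty. apply Def_or.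
  - apply Def_and; [exact H|].
    apply (Def_all C (fun y e => Q y (tail e) -> y = e 0)), Def_imp; [exact H1 | def].
  - apply Def_and; [|unfold is_set; def].
    apply Def_not, (Def_ex C (fun u e => Q u (tail e) /\ forall y, Q y (tail e) -> y = u)).
    apply Def_and; [exact H1|].
    apply (Def_all C (fun y e => Q y (tail (tail e)) -> y = e 0)), Def_imp; [exact H2 | def].
Qed.

Definition setof Q : M := iota (fun s => is_set s /\ forall z, z ∈ s <-> Q z).

Lemma DefT_setof C (Q : M -> (nat -> M) -> Prop) :
  Def C (fun e => Q (e 0) (tail e)) -> DefT C (fun e => setof (fun v => Q v e)).
Proof.
  intros H. apply (DefT_iota C (fun s e => is_set s /\ forall z, z ∈ s <-> Q z e)).
  apply Def_and; [unfold is_set; def|].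
  apply (Def_all C (fun z e => z ∈ e 0 <-> Q z (tail e))), Def_equiv; [def|].
  exact (Def_ren C _ (fun k => match k with 0 => 0 | S k => S (S k) end) H).
Qed.

Ltac def_term ::=
  match goal with
  | |- DefT ?C (fun e => iota (fun v => @?Q e v)) => apply (DefT_iota C (fun v e => Q e v))
  | |- DefT ?C (fun e => setof (fun v => @?Q e v)) => apply (DefT_setof C (fun v e => Q e v))
  | |- DefT ?C (fun e => ?f (@?a e) (@?b e) (@?c e)) =>
      apply (Fun3_app C f a b c); [def_leaf|..]
  | |- DefT ?C (fun e => ?f (@?a e) (@?b e)) => apply (Fun2_app C f a b); [def_leaf|..]
  | |- DefT ?C (fun e => ?f (@?a e)) => apply (Fun1_app C f a); [def_leaf|]
  end.

Hint Resolve Def1_is_set Def2_subset : def.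

Lemma setof_is_set Q : is_set (setof Q).
Proof. unfold setof. destruct (iota_or_empty (fun s => is_set s /\ forall z, z ∈ s <-> Q z))
  as [[[H _] _]|[_ [H _]]]; exact H. Qed.

Lemma setof_eq Q s : is_set s -> (forall z, z ∈ s <-> Q z) -> setof Q = s.
Proof.
  intros Hs H. apply iota_eq; [auto|]. intros y [Hy H']. apply set_ext; auto.
  intros z. now rewrite H, H'.
Qed.

Definition small Q : Prop := exists b, is_set b /\ forall z, Q z -> z ∈ b.

Lemma separation_class Q x : Def1 any Q -> is_set x ->
  exists y, is_set y /\ forall z, z ∈ y <-> z ∈ x /\ Q z.
Proof.
  intros (phi & s & _ & H) Hx.
  destruct (ZFU_separation _ hZFU (rename (fun i => match s i with inl _ => 0 | _ => S i end) phi)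
    (fun i => match s i with inl _ => x | inr m => m end) x Hx) as (y & Hy & Hy').
  exists y. split; [exact Hy|]. intros z. rewrite Hy', sat_rename, (H (fun _ => z)).
  enough (E : forall P P', (P <-> P') -> (z ∈ x /\ P <-> z ∈ x /\ P')).
  { apply E, sat_ext. intros i. unfold assign. destruct (s i) eqn:Ei; cbn; now rewrite ?Ei. }
  tauto.
Qed.

Lemma replacement_fun f w : Fun1 any f -> is_set w ->
  exists v, is_set v /\ forall y, y ∈ v <-> exists x, x ∈ w /\ y = f x.
Proof.
  intros (phi & s & _ & H) Hw.
  set (phi' := rename (fun i => match s i with inl 0 => 1 | inl (S _) => 0 | _ => S (S i) end) phi).
  set (rho := fun i => match s i with inl _ => w | inr m => m end).
  assert (E : forall x y, sat (scons x (scons y rho)) phi' <-> y = f x).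
  { intros x y. unfold phi'. rewrite sat_rename, (H (scons y (fun _ => x))).
    apply sat_ext. intros i. unfold assign. destruct (s i) as [[|j]|] eqn:Ei; cbn; auto.
    unfold rho. now rewrite Ei. }
  destruct (ZFU_replacement _ hZFU phi' rho w Hw) as (v & Hv & Hv').
  - intros x _. exists (f x). split; [now apply E|]. intros y Hy. symmetry. now apply E.
  - exists v. split; [exact Hv|]. intros y. rewrite Hv'.
    split; intros (x & Hx & Hy); exists x; (split; [exact Hx|]); now apply E.
Qed.

Lemma mem_setof Q : Def1 any Q -> small Q -> forall z, z ∈ setof Q <-> Q z.
Proof.
  intros HQ (b & Hb & HQb). destruct (separation_class Q b HQ Hb) as (y & Hy & H).
  rewrite (setof_eq Q y); [| exact Hy |]; intros z; rewrite H; split; try tauto; auto.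
Qed.

Lemma small_sub P Q : (forall z, P z -> Q z) -> small Q -> small P.
Proof. intros H (b & Hb & Hb'). exists b. auto. Qed.

Lemma same_members x : exists x', is_set x' /\ forall z, z ∈ x' <-> z ∈ x.
Proof.
  destruct (classic (ur x)) as [Hx|Hx].
  - destruct exists_empty as (e & He & He'). exists e. split; [exact He|].
    intros z. split; intros H; [destruct (He' z H) | destruct (ur_no_mem x z Hx H)].
  - exists x. split; [exact Hx | reflexivity].
Qed.

Lemma small_mem x : small (fun z => z ∈ x).
Proof. destruct (same_members x) as (x' & H & H'). exists x'. split; [exact H|]. intros z. apply H'. Qed.

Lemma small_union x : small (fun z => exists y, y ∈ x /\ z ∈ y).
Proof.
  destruct (same_members x) as (x' & Hx & H). destruct (ZFU_union _ hZFU x' Hx) as (u & Hu & H').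
  exists u. split; [exact Hu|]. intros z (y & Hy & Hz). apply H'. exists y. split; [now apply H | exact Hz].
Qed.

Lemma small_pair a b : small (fun z => z = a \/ z = b).
Proof. destruct (ZFU_pairing _ hZFU a b) as (u & Hu & H). exists u. split; [exact Hu|]. intros z. apply H. Qed.

Lemma small_power x : small (fun z => is_set z /\ subset z x).
Proof.
  destruct (same_members x) as (x' & Hx & H). destruct (ZFU_powerset _ hZFU x' Hx) as (u & Hu & H').
  exists u. split; [exact Hu|]. intros z [Hz Hz']. apply H'. split; [exact Hz|].
  intros t Ht. apply H, Hz', Ht.
Qed.

Lemma small_image f x : Fun1 any f -> small (fun y => exists z, z ∈ x /\ y = f z).
Proof.
  intros Hf. destruct (same_members x) as (x' & Hx & H).
  destruct (replacement_fun f x' Hf Hx) as (v & Hv & H'). exists v. split; [exact Hv|].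
  intros y (z & Hz & Hy). apply H'. exists z. split; [now apply H | exact Hy].
Qed.

(** * Basic set operations *)

Definition upair a b := setof (fun z => z = a \/ z = b).
Definition union_of x := setof (fun z => exists y, y ∈ x /\ z ∈ y).
Definition power x := setof (fun z => is_set z /\ subset z x).
Definition cup a b := setof (fun z => z ∈ a \/ z ∈ b).
Definition image f x := setof (fun y => exists z, z ∈ x /\ y = f z).
Definition opair a b := upair (upair a a) (upair a b).

Lemma mem_upair a b z : z ∈ upair a b <-> z = a \/ z = b.
Proof. apply (mem_setof (fun z => z = a \/ z = b)); [def | apply small_pair]. Qed.

Lemma mem_union_of x z : z ∈ union_of x <-> exists y, y ∈ x /\ z ∈ y.
Proof. apply (mem_setof (fun z => exists y, y ∈ x /\ z ∈ y)); [def | apply small_union]. Qed.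

Lemma mem_power x z : z ∈ power x <-> is_set z /\ subset z x.
Proof. apply (mem_setof (fun z => is_set z /\ subset z x)); [def | apply small_power]. Qed.

Lemma small_or P Q : small P -> small Q -> small (fun z => P z \/ Q z).
Proof.
  intros (b & Hb & HP) (c & Hc & HQ).
  destruct (small_union (upair b c)) as (u & Hu & H).
  exists u. split; [exact Hu|]. intros z Hz. apply H.
  destruct Hz; [exists b | exists c]; (split; [apply mem_upair|]; auto).
Qed.

Lemma mem_cup a b z : z ∈ cup a b <-> z ∈ a \/ z ∈ b.
Proof. apply (mem_setof (fun z => z ∈ a \/ z ∈ b)); [def | apply small_or; apply small_mem]. Qed.

Lemma mem_image f x : Fun1 any f -> forall y, y ∈ image f x <-> exists z, z ∈ x /\ y = f z.
Proof. intros Hf. apply (mem_setof (fun y => exists z, z ∈ x /\ y = f z)); [def | now apply small_image]. Qed.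

Lemma Fun2_upair C : Fun2 C upair. Proof. unfold upair. def. Qed.
Lemma Fun1_union_of C : Fun1 C union_of. Proof. unfold union_of. def. Qed.
Lemma Fun1_power C : Fun1 C power. Proof. unfold power. def. Qed.
Lemma Fun2_cup C : Fun2 C cup. Proof. unfold cup. def. Qed.
Lemma Fun1_image C f : Fun1 C f -> Fun1 C (image f).
Proof. intros Hf. unfold image. def. Qed.
Hint Resolve Fun2_upair Fun1_union_of Fun1_power Fun2_cup Fun1_image : def.
Lemma Fun2_opair C : Fun2 C opair. Proof. unfold opair. def. Qed.
Hint Resolve Fun2_opair : def.

Lemma upair_is_set a b : is_set (upair a b). Proof. apply setof_is_set. Qed.
Lemma cup_is_set a b : is_set (cup a b). Proof. apply setof_is_set. Qed.
Lemma image_is_set f x : is_set (image f x). Proof. apply setof_is_set. Qed.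

Lemma upair_inj a b c d : upair a b = upair c d -> (a = c /\ b = d) \/ (a = d /\ b = c).
Proof.
  intros E.
  assert (Ha : a ∈ upair c d) by (rewrite <- E; apply mem_upair; auto).
  assert (Hb : b ∈ upair c d) by (rewrite <- E; apply mem_upair; auto).
  assert (Hc : c ∈ upair a b) by (rewrite E; apply mem_upair; auto).
  assert (Hd : d ∈ upair a b) by (rewrite E; apply mem_upair; auto).
  apply mem_upair in Ha, Hb, Hc, Hd.
  destruct Ha as [-> | ->], Hb as [-> | ->]; auto; destruct Hc, Hd; subst; auto.
Qed.

Lemma opair_inj a b c d : opair a b = opair c d -> a = c /\ b = d.
Proof.
  intros E. apply upair_inj in E. destruct E as [[E1 E2]|[E1 E2]];
    apply upair_inj in E1, E2; destruct E1 as [[]|[]], E2 as [[]|[]]; subst; auto.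
Qed.

Lemma is_upair_iff u a b : is_upair u a b <-> u = upair a b.
Proof.
  split.
  - intros [Hu H]. apply set_ext; [exact Hu | apply upair_is_set|].
    intros z. now rewrite H, mem_upair.
  - intros ->. split; [apply upair_is_set | intros z; apply mem_upair].
Qed.

Lemma is_opair_iff u a b : is_opair u a b <-> u = opair a b.
Proof.
  unfold is_opair. split.
  - intros (v & w & Hv & Hw & Hu). apply is_upair_iff in Hv, Hw, Hu. now subst.
  - intros ->. exists (upair a a), (upair a b). now rewrite !is_upair_iff.
Qed.

Lemma maps_iff f a b : maps f a b <-> opair a b ∈ f.
Proof.
  unfold maps. split.
  - intros (u & Hu & H). apply is_opair_iff in Hu. now subst.
  - exists (opair a b). now rewrite is_opair_iff.
Qed.

Lemma not_self_mem x : ~ x ∈ x.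
Proof.
  intros H. destruct (ZFU_foundation _ hZFU (upair x x)) as (y & Hy & Hy').
  - apply upair_is_set.
  - exists x. apply mem_upair. auto.
  - apply mem_upair in Hy. assert (y = x) as -> by tauto.
    apply (Hy' x); [apply mem_upair; auto | exact H].
Qed.

(** * Recursion *)

Section Recursion.
Variables (pred : M -> M -> Prop) (G : M -> M -> M).

(** [f] is a set of pairs, not necessarily functional, each of which is justified by
    pairs in [f].  Functionality follows by induction, for the union of all attempts. *)
Definition attempt f : Prop :=
  forall y u, opair y u ∈ f ->
  exists S, is_set S /\ (forall v, v ∈ S <-> exists y', pred y' y /\ opair y' v ∈ f)
  /\ (forall y', pred y' y -> exists v, opair y' v ∈ f) /\ u = G y S.

Definition rec_graph x v : Prop := exists f, attempt f /\ opair x v ∈ f.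

Definition rec x : M := iota (fun v => rec_graph x v).

Lemma Def2_rec_graph C : Def2 C pred -> Fun2 C G -> Def2 C rec_graph.
Proof. intros Hp HG. unfold rec_graph, attempt. def. Qed.

Lemma Fun1_rec C : Def2 C pred -> Fun2 C G -> Fun1 C rec.
Proof. intros Hp HG. pose proof (Def2_rec_graph C Hp HG). unfold rec. def. Qed.

Hypothesis Hpred : Def2 any pred.
Hypothesis HG : Fun2 any G.
Hypothesis pred_ind : forall Q, Def1 any Q ->
  (forall x, (forall y, pred y x -> Q y) -> Q x) -> forall x, Q x.
Hypothesis pred_closure : forall x,
  exists c, x ∈ c /\ forall y z, y ∈ c -> pred z y -> z ∈ c.

Lemma rec_graph_unique : forall x v v', rec_graph x v -> rec_graph x v' -> v = v'.
Proof.
  pose proof (Def2_rec_graph any Hpred HG) as Hg.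
  apply (pred_ind (fun x => forall v v', rec_graph x v -> rec_graph x v' -> v = v')); [def|].
  intros x IH.
  assert (Hsub : forall f f' S S', attempt f -> attempt f' ->
    (forall v, v ∈ S <-> exists y, pred y x /\ opair y v ∈ f) ->
    (forall v, v ∈ S' <-> exists y, pred y x /\ opair y v ∈ f') ->
    (forall y, pred y x -> exists v, opair y v ∈ f') ->
    forall v, v ∈ S -> v ∈ S').
  { intros f f' S S' Hf Hf' HS HS' Hd v Hv. apply HS in Hv. destruct Hv as (y & Hy & Hyv).
    destruct (Hd y Hy) as [v' Hv']. apply HS'. exists y. split; [exact Hy|].
    assert (v = v') as ->; [|exact Hv']. apply (IH y Hy); [exists f | exists f']; auto. }
  intros v v' (f & Hf & Hv) (f' & Hf' & Hv').
  destruct (Hf _ _ Hv) as (S & HS & HS1 & HS2 & ->).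
  destruct (Hf' _ _ Hv') as (S' & HS' & HS1' & HS2' & ->).
  replace S' with S; [reflexivity|]. apply set_ext; auto.
  intros z. split; eauto.
Qed.

Lemma rec_graph_total : forall x, exists v, rec_graph x v.
Proof.
  pose proof (Def2_rec_graph any Hpred HG) as Hg.
  apply (pred_ind (fun x => exists v, rec_graph x v)); [def|].
  intros x IH. apply NNPP. intros N. destruct (pred_closure x) as (c & Hxc & Hc).
  set (f := setof (fun q => exists y u, y ∈ c /\ rec_graph y u /\ q = opair y u)).
  assert (Hf : forall q, q ∈ f <-> exists y u, y ∈ c /\ rec_graph y u /\ q = opair y u).
  { apply mem_setof; [def|].
    apply small_sub with (fun q => exists y, y ∈ c /\ q = opair y (rec y)).
    - intros q (y & u & Hy & Hu & ->). exists y. split; [exact Hy|]. f_equal.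
      symmetry. apply iota_eq; [exact Hu|]. intros u' Hu'. eapply rec_graph_unique; eauto.
    - pose proof (Fun1_rec any Hpred HG). apply (small_image (fun y => opair y (rec y))). def. }
  assert (Hf' : forall y u, opair y u ∈ f <-> y ∈ c /\ rec_graph y u).
  { intros y u. rewrite Hf. split.
    - intros (y' & u' & Hy & Hu & E). apply opair_inj in E. destruct E; now subst.
    - intros [Hy Hu]. exists y, u. auto. }
  set (S := setof (fun v => exists y, pred y x /\ opair y v ∈ f)).
  assert (HS : forall v, v ∈ S <-> exists y, pred y x /\ opair y v ∈ f).
  { apply mem_setof; [def|].
    apply small_sub with (fun v => exists y, y ∈ c /\ v = rec y).
    - intros v (y & Hy & Hv). apply Hf' in Hv. destruct Hv as [Hyc Hv]. exists y.
      split; [exact Hyc|]. symmetry. apply iota_eq; [exact Hv|].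
      intros u' Hu'. eapply rec_graph_unique; eauto.
    - apply small_image, Fun1_rec; assumption. }
  apply N. exists (G x S), (cup f (upair (opair x (G x S)) (opair x (G x S)))).
  split; [|apply mem_cup; right; apply mem_upair; auto].
  (* An object without a value precedes neither itself nor any object that has a value. *)
  assert (Hcup : forall y u, opair y u ∈ cup f (upair (opair x (G x S)) (opair x (G x S)))
    <-> opair y u ∈ f \/ y = x /\ u = G x S).
  { intros y u. rewrite mem_cup, mem_upair. split; (intros [H|H]; [now left|right]).
    - assert (E : opair y u = opair x (G x S)) by tauto. now apply opair_inj in E.
    - destruct H; subst; auto. }
  assert (Hsame : forall y, ~ pred x y -> forall v,
    (exists y', pred y' y /\ opair y' v ∈ cup f (upair (opair x (G x S)) (opair x (G x S))))
    <-> (exists y', pred y' y /\ opair y' v ∈ f)).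
  { intros y Hy v. split; intros (y' & H & H'); exists y'; (split; [exact H|]).
    - apply Hcup in H'. destruct H' as [H'|[-> _]]; [exact H' | contradiction].
    - apply Hcup. now left. }
  intros y u Hyu. apply Hcup in Hyu. destruct Hyu as [Hyu|[-> ->]].
  - apply Hf' in Hyu. destruct Hyu as [Hyc (g & Hg1 & Hyu)].
    destruct (Hg1 _ _ Hyu) as (S' & HS' & HS1 & HS2 & ->).
    assert (Hx : ~ pred x y).
    { intros Hx. destruct (HS2 x Hx) as [v Hv]. apply N. exists v, g. auto. }
    exists S'. split; [exact HS'|]. split; [|split; [|reflexivity]].
    + intros v. rewrite Hsame, HS1 by exact Hx.
      split; intros (y' & Hy' & Hv); exists y'; (split; [exact Hy'|]).
      * apply Hf'. split; [eauto|]. exists g. auto.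
      * apply Hf' in Hv. destruct Hv as [_ Hv]. destruct (HS2 y' Hy') as [v' Hv'].
        assert (v = v') as ->; [|exact Hv']. eapply rec_graph_unique; [exact Hv|]. exists g. auto.
    + intros y' Hy'. destruct (HS2 y' Hy') as [v Hv]. exists v. apply Hcup. left.
      apply Hf'. split; [eauto|]. exists g. auto.
  - assert (Hx : ~ pred x x) by (intros Hx; apply N, IH, Hx).
    exists S. split; [apply setof_is_set|]. split; [|split; [|reflexivity]].
    + intros v. now rewrite Hsame, HS by exact Hx.
    + intros y Hy. destruct (IH y Hy) as [v Hv]. exists v. apply Hcup. left.
      apply Hf'. eauto.
Qed.

Lemma rec_graph_iff x v : rec_graph x v <-> v = rec x.
Proof.
  assert (H : rec_graph x (rec x))
    by exact (iota_spec (rec_graph x) (rec_graph_total x) (rec_graph_unique x)).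
  split; [|now intros ->]. intros Hv. eapply rec_graph_unique; eauto.
Qed.

Lemma rec_eq x : rec x = G x (setof (fun v => exists y, pred y x /\ v = rec y)).
Proof.
  destruct (proj2 (rec_graph_iff x _) eq_refl) as (f & Hf & Hx).
  destruct (Hf _ _ Hx) as (S & HS & HS1 & HS2 & E). rewrite E at 1. f_equal.
  symmetry. apply setof_eq; [exact HS|]. intros v. rewrite HS1.
  assert (Hval : forall y u, opair y u ∈ f -> u = rec y)
    by (intros y u H; apply rec_graph_iff; exists f; auto).
  split; intros (y & Hy & Hv); exists y; (split; [exact Hy|]); [auto|].
  destruct (HS2 y Hy) as [u Hu]. rewrite Hv, <- (Hval _ _ Hu). exact Hu.
Qed.

End Recursion.

(** Recursion along the membership relation of a set [w] needs no transitive closures,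
    since every subset of [w] has a minimal element.  For the infinite set, therefore,
    s(n) = x ∪ ⋃ ⋃ {s(m) | m ∈ n} makes sense for all its elements [n], and the
    union of the s(n) is transitive because s(n ∪ {n}) includes ⋃ s(n). *)
Lemma transitive_closure_exists x :
  exists c, is_set c /\ subset x c /\ forall y, y ∈ c -> subset y c.
Proof.
  destruct (ZFU_infinity _ hZFU) as (w & Hw & (e & Hew & He & _) & Hsucc).
  set (pred y z := y ∈ z /\ z ∈ w /\ y ∈ w).
  assert (Hpred : Def2 any pred) by (unfold pred; def).
  set (G (n S : M) := cup x (union_of (union_of S))).
  assert (HG : Fun2 any G) by (unfold G; def).
  assert (Hind : forall Q, Def1 any Q ->
    (forall z, (forall y, pred y z -> Q y) -> Q z) -> forall z, Q z).
  { intros Q HQ H z. apply NNPP. intros N.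
    assert (Hout : forall z, ~ z ∈ w -> Q z) by (intros y Hy; apply H; intros u Hu; now destruct Hu as (_ & ? & _)).
    destruct (separation_class (fun z => ~ Q z) w) as (b & Hb & Hb'); [def | exact Hw |].
    destruct (ZFU_foundation _ hZFU b Hb) as (y & Hy & Hmin).
    - exists z. apply Hb'. split; [apply NNPP; auto | exact N].
    - apply Hb' in Hy. destruct Hy as [Hyw Hy]. apply Hy, H. intros u (Huy & _ & Hu).
      apply NNPP. intros Nu. apply (Hmin u); [|exact Huy]. apply Hb'. auto. }
  assert (Hclos : forall z, exists c, z ∈ c /\ forall y u, y ∈ c -> pred u y -> u ∈ c).
  { intros z. exists (cup w (upair z z)). split; [apply mem_cup; right; apply mem_upair; auto|].
    intros y u _ (_ & _ & Hu). apply mem_cup. auto. }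
  set (s := rec pred G).
  assert (Hs : Fun1 any s) by (apply Fun1_rec; assumption).
  assert (Eq : forall n z, z ∈ s n <-> z ∈ x \/ exists m y, pred m n /\ y ∈ s m /\ z ∈ y).
  { intros n z. unfold s. rewrite rec_eq by assumption. fold s. unfold G.
    rewrite mem_cup, mem_union_of.
    enough (E : (exists y, y ∈ union_of (setof (fun v => exists m, pred m n /\ v = s m)) /\ z ∈ y)
      <-> (exists m y, pred m n /\ y ∈ s m /\ z ∈ y)) by now rewrite E.
    assert (Hset : forall v, v ∈ setof (fun v => exists m, pred m n /\ v = s m)
      <-> exists m, pred m n /\ v = s m).
    { apply mem_setof; [def|]. apply small_sub with (fun v => exists m, m ∈ w /\ v = s m).
      - intros v (m & (_ & _ & Hm) & ->). eauto.
      - now apply small_image. }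
    split.
    - intros (y & Hy & Hz). apply mem_union_of in Hy. destruct Hy as (v & Hv & Hy).
      apply Hset in Hv. destruct Hv as (m & Hm & ->). eauto.
    - intros (m & y & Hm & Hy & Hz). exists y. split; [|exact Hz]. apply mem_union_of.
      exists (s m). split; [|exact Hy]. apply Hset. eauto. }
  exists (setof (fun z => exists n, (n ∈ w /\ is_set n) /\ z ∈ s n)).
  assert (Hc : forall z, z ∈ setof (fun z => exists n, (n ∈ w /\ is_set n) /\ z ∈ s n)
    <-> exists n, (n ∈ w /\ is_set n) /\ z ∈ s n).
  { apply mem_setof; [def|].
    apply small_sub with (fun z => exists v, v ∈ image s w /\ z ∈ v); [|apply small_union].
    intros z (n & [Hn _] & Hz). exists (s n). split; [|exact Hz]. apply mem_image; eauto. }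
  split; [apply setof_is_set|]. split.
  - intros z Hz. apply Hc. exists e. split; [auto|]. apply Eq. auto.
  - intros y Hy z Hz. apply Hc in Hy. destruct Hy as (n & [Hn Hns] & Hy).
    destruct (Hsucc n Hn Hns) as (n' & Hn' & Hns' & Hn'n).
    apply Hc. exists n'. split; [auto|]. apply Eq. right. exists n, y.
    split; [|auto]. split; [|auto]. apply Hn'n. auto.
Qed.

Lemma transitive_closure x :
  exists c, is_set c /\ x ∈ c /\ forall y z, y ∈ c -> z ∈ y -> z ∈ c.
Proof.
  destruct (transitive_closure_exists (upair x x)) as (c & Hc & Hx & H).
  exists c. split; [exact Hc|]. split; [apply Hx, mem_upair; auto|].
  intros y z Hy Hz. exact (H y Hy z Hz).
Qed.

Lemma mem_ind Q : Def1 any Q -> (forall x, (forall y, y ∈ x -> Q y) -> Q x) -> forall x, Q x.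
Proof.
  intros HQ H x. apply NNPP. intros N.
  destruct (transitive_closure x) as (c & Hc & Hx & Htr).
  destruct (separation_class (fun z => ~ Q z) c) as (b & Hb & Hb'); [def | exact Hc |].
  destruct (ZFU_foundation _ hZFU b Hb) as (y & Hy & Hmin).
  - exists x. now apply Hb'.
  - apply Hb' in Hy. destruct Hy as [Hyc Hy]. apply Hy, H. intros z Hz.
    apply NNPP. intros Nz. apply (Hmin z); [|exact Hz]. apply Hb'. eauto.
Qed.

Definition mem_rec (G : M -> M -> M) : M -> M := rec mem G.

Lemma Fun1_mem_rec C G : Fun2 C G -> Fun1 C (mem_rec G).
Proof. apply Fun1_rec, Def2_mem. Qed.

Lemma mem_rec_eq G : Fun2 any G -> forall x, mem_rec G x = G x (image (mem_rec G) x).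
Proof.
  intros HG x. apply rec_eq; [apply Def2_mem | exact HG | apply mem_ind |].
  intros y. destruct (transitive_closure y) as (c & _ & H). eauto.
Qed.

(** * Rank, support and the sets of bounded rank and support *)

Definition rank_step x S : M := setof (fun z => is_set z /\ exists s, s ∈ S /\ subset z s).

(** The level V_α of pure sets, where α is the rank of [x].  It serves as the rank itself,
    so that no ordinals are needed. *)
Definition rank : M -> M := mem_rec rank_step.

Definition rank_le x y : Prop := subset (rank x) (rank y).
Definition rank_lt x y : Prop := rank x ∈ rank y.

Definition support_step x S : M :=
  setof (fun z => (ur x /\ z = x) \/ exists s, s ∈ S /\ z ∈ s).

Definition support : M -> M := mem_rec support_step.

Definition stage A x : M := setof (fun z => subset (support z) A /\ rank_le z x).

Lemma Fun1_rank C : Fun1 C rank.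
Proof. apply Fun1_mem_rec. unfold rank_step. def. Qed.
Hint Resolve Fun1_rank : def.

Lemma Fun1_support C : Fun1 C support.
Proof. apply Fun1_mem_rec. unfold support_step. def. Qed.
Hint Resolve Fun1_support : def.

Lemma Def2_rank_le C : Def2 C rank_le.
Proof. unfold rank_le. def. Qed.

Lemma Def2_rank_lt C : Def2 C rank_lt.
Proof. unfold rank_lt. def. Qed.
Hint Resolve Def2_rank_le Def2_rank_lt : def.

Lemma Fun2_stage C : Fun2 C stage.
Proof. unfold stage. def. Qed.
Hint Resolve Fun2_stage : def.

Lemma mem_rank x z : z ∈ rank x <-> is_set z /\ exists y, y ∈ x /\ subset z (rank y).
Proof.
  unfold rank. rewrite mem_rec_eq by (unfold rank_step; def). fold rank. unfold rank_step.
  assert (Hi : forall s, s ∈ image rank x <-> exists y, y ∈ x /\ s = rank y)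
    by (apply mem_image; def).
  assert (E : (exists s, s ∈ image rank x /\ subset z s) <-> exists y, y ∈ x /\ subset z (rank y)).
  { split.
    - intros (s & Hs & H). apply Hi in Hs. destruct Hs as (y & Hy & ->). eauto.
    - intros (y & Hy & H). exists (rank y). split; [|exact H]. apply Hi. eauto. }
  rewrite <- E. apply (mem_setof (fun z => is_set z /\ exists s, s ∈ image rank x /\ subset z s)); [def|].
  apply small_sub with (fun z => exists u, u ∈ image power (image rank x) /\ z ∈ u); [|apply small_union].
  intros u (Hu & s & Hs & H). exists (power s). split; [|now apply mem_power].
  apply mem_image; [def|]. eauto.
Qed.

Lemma rank_is_set x : is_set (rank x).
Proof. unfold rank. rewrite mem_rec_eq by (unfold rank_step; def). apply setof_is_set. Qed.

Lemma mem_support x z : z ∈ support x <-> (ur x /\ z = x) \/ exists y, y ∈ x /\ z ∈ support y.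
Proof.
  unfold support. rewrite mem_rec_eq by (unfold support_step; def). fold support.
  unfold support_step.
  assert (Hi : forall s, s ∈ image support x <-> exists y, y ∈ x /\ s = support y)
    by (apply mem_image; def).
  rewrite (mem_setof (fun z => (ur x /\ z = x) \/ exists s, s ∈ image support x /\ z ∈ s)).
  - split; (intros [H|H]; [now left|right]).
    + destruct H as (s & Hs & H). apply Hi in Hs. destruct Hs as (y & Hy & ->). eauto.
    + destruct H as (y & Hy & H). exists (support y). split; [|exact H]. apply Hi. eauto.
  - def.
  - apply small_or; [|apply small_union].
    apply small_sub with (fun z => z = x \/ z = x); [tauto | apply small_pair].
Qed.

Lemma support_ur x : forall z, z ∈ support x -> ur z.
Proof.
  revert x. apply (mem_ind (fun x => forall z, z ∈ support x -> ur z)); [def|].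
  intros x IH z Hz. apply mem_support in Hz. destruct Hz as [[H ->]|(y & Hy & Hz)]; eauto.
Qed.

Lemma support_mem x y : y ∈ x -> subset (support y) (support x).
Proof. intros H z Hz. apply mem_support. eauto. Qed.

Lemma support_subset x A : is_set x ->
  (subset (support x) A <-> forall y, y ∈ x -> subset (support y) A).
Proof.
  intros Hx. split.
  - intros H y Hy z Hz. apply H, (support_mem x y Hy z Hz).
  - intros H z Hz. apply mem_support in Hz. destruct Hz as [[Hu _]|(y & Hy & Hz)]; [contradiction|].
    exact (H y Hy z Hz).
Qed.

Lemma rank_transitive x : forall y, y ∈ rank x -> subset y (rank x).
Proof.
  revert x. apply (mem_ind (fun x => forall y, y ∈ rank x -> subset y (rank x))); [def|].
  intros x IH y Hy z Hz. apply mem_rank in Hy. destruct Hy as (_ & b & Hb & Hy).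
  specialize (Hy z Hz). apply mem_rank. split.
  - apply mem_rank in Hy. tauto.
  - exists b. split; [exact Hb | exact (IH b Hb z Hy)].
Qed.

Lemma rank_le_refl x : rank_le x x.
Proof. intros z Hz. exact Hz. Qed.

Lemma rank_le_trans x y z : rank_le x y -> rank_le y z -> rank_le x z.
Proof. intros H H' u Hu. apply H', H, Hu. Qed.

Lemma rank_lt_iff x y : rank_lt x y <-> exists y', y' ∈ y /\ rank_le x y'.
Proof.
  unfold rank_lt. rewrite mem_rank. split; [intros [_ H]; exact H|].
  intros H. split; [apply rank_is_set | exact H].
Qed.

Lemma rank_lt_mem x y : x ∈ y -> rank_lt x y.
Proof. intros H. apply rank_lt_iff. exists x. split; [exact H | apply rank_le_refl]. Qed.

Lemma rank_lt_le x y : rank_lt x y -> rank_le x y.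
Proof. apply rank_transitive. Qed.

Lemma rank_le_mem x y : x ∈ y -> rank_le x y.
Proof. intros H. now apply rank_lt_le, rank_lt_mem. Qed.

Lemma rank_lt_le_trans x y z : rank_lt x y -> rank_le y z -> rank_lt x z.
Proof. intros H H'. apply H', H. Qed.

Lemma rank_le_lt_trans x y z : rank_le x y -> rank_lt y z -> rank_lt x z.
Proof.
  rewrite !rank_lt_iff. intros H (z' & Hz & H'). exists z'. split; [exact Hz|].
  now apply rank_le_trans with y.
Qed.

Lemma rank_lt_irrefl x : ~ rank_lt x x.
Proof. apply not_self_mem. Qed.

Lemma rank_le_intro x y : (forall x', x' ∈ x -> rank_lt x' y) -> rank_le x y.
Proof.
  intros H z Hz. apply mem_rank in Hz. destruct Hz as (Hz & x' & Hx' & Hzx').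
  apply H, rank_lt_iff in Hx'. destruct Hx' as (y' & Hy' & Hle).
  apply mem_rank. split; [exact Hz|]. exists y'. split; [exact Hy'|].
  intros t Ht. apply Hle, Hzx', Ht.
Qed.

(** If every member of [x] has smaller rank than [y], the left case holds.  Otherwise
    the claim for [y] and that member is needed, which reduces in the same way to members
    of both, so induction on the first argument suffices. *)
Lemma rank_le_or_lt : forall x y, rank_le x y \/ rank_lt y x.
Proof.
  apply (mem_ind (fun x => forall y, rank_le x y \/ rank_lt y x)); [def|].
  intros x IH y. destruct (classic (rank_lt y x)) as [|N]; [now right | left].
  apply rank_le_intro. intros x' Hx'.
  apply NNPP. intros N'. apply N, rank_lt_iff. exists x'. split; [exact Hx'|].
  apply rank_le_intro. intros y' Hy'. destruct (IH x' Hx' y') as [H|H]; [|exact H].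
  destruct N'. apply rank_lt_iff. eauto.
Qed.

(** The ranks are linearly ordered, so a failure of minimality at [y] gives an element of the
    class of rank at most that of a member of any [x] that bounds the rank of [y]. *)
Lemma rank_minimal Q : Def1 any Q -> (exists x, Q x) ->
  exists x, Q x /\ forall z, Q z -> rank_le x z.
Proof.
  intros HQ [x0 H0]. apply NNPP. intros N.
  assert (H : forall x, ~ exists y, Q y /\ rank_le y x).
  { apply (mem_ind (fun x => ~ exists y, Q y /\ rank_le y x)); [def|].
    intros x IH (y & Hy & Hyx). apply N. exists y. split; [exact Hy|].
    intros z Hz. destruct (rank_le_or_lt y z) as [|Hlt]; [assumption|].
    apply (rank_lt_le_trans _ _ x) in Hlt; [|exact Hyx].
    apply rank_lt_iff in Hlt. destruct Hlt as (x' & Hx' & Hle). destruct (IH x' Hx'). eauto. }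
  apply (H x0). exists x0. split; [exact H0 | apply rank_le_refl].
Qed.

Lemma rank_le_rank x : rank_le x (rank x).
Proof.
  revert x. apply (mem_ind (fun x => rank_le x (rank x))); [def|].
  intros x IH. apply rank_le_intro. intros y Hy.
  apply rank_le_lt_trans with (rank y); [now apply IH|].
  apply rank_lt_mem, rank_lt_mem, Hy.
Qed.

Lemma support_rank x : forall z, ~ z ∈ support (rank x).
Proof.
  assert (H : forall x y, y ∈ rank x -> forall z, ~ z ∈ support y).
  { apply (mem_ind (fun x => forall y, y ∈ rank x -> forall z, ~ z ∈ support y)); [def|].
    intros b IH y Hy z Hz. apply mem_rank in Hy. destruct Hy as (Hy & c & Hc & Hyc).
    apply mem_support in Hz. destruct Hz as [[Hu _]|(d & Hd & Hz)]; [contradiction|].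
    exact (IH c Hc d (Hyc d Hd) z Hz). }
  intros z Hz. apply mem_support in Hz. destruct Hz as [[Hu _]|(y & Hy & Hz)].
  - exact (rank_is_set x Hu).
  - exact (H x y Hy z Hz).
Qed.

(** The rank of the objects of least rank that satisfy [Q], if there are any.  Unlike
    these objects it is unique, which makes it usable in instances of Replacement. *)
Definition least_rank Q : M :=
  iota (fun v => exists x, Q x /\ (forall z, Q z -> rank_le x z) /\ v = rank x).

Lemma least_rank_spec Q : Def1 any Q -> (exists x, Q x) ->
  (forall x y, Q x -> rank_le x y -> Q y) ->
  Q (least_rank Q) /\ exists x, least_rank Q = rank x.
Proof.
  intros HQ Hex Hup. destruct (rank_minimal Q HQ Hex) as (x & Hx & Hmin).
  assert (E : least_rank Q = rank x).
  { apply iota_eq; [eauto|]. intros v (y & Hy & Hy' & ->).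
    apply set_ext; try apply rank_is_set. intros z. split; [apply Hy' | apply Hmin]; auto. }
  rewrite E. split; [|eauto]. exact (Hup x _ Hx (rank_le_rank x)).
Qed.

(** A form of Collection in which only the ranks of the witnesses are collected. *)
Lemma rank_bounding (B : M -> M -> Prop) t : Def2 any B ->
  (forall x b b', B x b -> rank_le b b' -> B x b') ->
  (forall x, x ∈ t -> exists b, B x b) -> exists b, forall x, x ∈ t -> B x b.
Proof.
  intros HB Hup H.
  set (f x := least_rank (fun b => B x b)).
  assert (Hf : Fun1 any f) by (unfold f, least_rank; def).
  exists (image f t). intros x Hx. apply Hup with (f x).
  - apply (least_rank_spec (fun b => B x b)); [def | auto | intros b b'; apply Hup].
  - apply rank_le_mem, mem_image; eauto.
Qed.

(** The content is that the objects of bounded rank and support form a set: the members of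
    such an object lie in the stages of the members of [x]. *)
Lemma mem_stage A x z : z ∈ stage A x <-> subset (support z) A /\ rank_le z x.
Proof.
  assert (H : forall x z, z ∈ stage A x <-> subset (support z) A /\ rank_le z x);
    [|apply H].
  apply (mem_ind (fun x => forall z, z ∈ stage A x <-> subset (support z) A /\ rank_le z x)); [def|].
  intros b IH. apply mem_setof; [def|].
  apply small_sub with (fun z => z ∈ A \/ z ∈ power (union_of (image (stage A) b))).
  - intros y [Hy Hr]. destruct (classic (ur y)) as [Hu|Hs]; [left|right].
    + apply Hy, mem_support. auto.
    + apply mem_power. split; [exact Hs|]. intros c Hc.
      assert (Hlt : rank_lt c b) by (apply rank_lt_le_trans with y; [now apply rank_lt_mem | exact Hr]).
      apply rank_lt_iff in Hlt. destruct Hlt as (b' & Hb' & Hle).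
      apply mem_union_of. exists (stage A b'). split; [apply mem_image; [def | eauto]|].
      apply IH; [exact Hb'|]. split; [|exact Hle]. now apply (support_subset y).
  - apply small_or; apply small_mem.
Qed.

Lemma stage_is_set A x : is_set (stage A x).
Proof. apply setof_is_set. Qed.

(** * Equinumerous sets *)

Lemma equinumerous_intro F G x y : Fun1 any F -> is_set x -> is_set y ->
  (forall a, a ∈ x -> F a ∈ y /\ G (F a) = a) ->
  (forall b, b ∈ y -> G b ∈ x /\ F (G b) = b) -> equinumerous x y.
Proof.
  intros HF Hx Hy Hxy Hyx. split; [exact Hx|]. split; [exact Hy|].
  exists (image (fun a => opair a (F a)) x).
  assert (Hf : forall u, u ∈ image (fun a => opair a (F a)) x <-> exists a, a ∈ x /\ u = opair a (F a))
    by (apply mem_image; def).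
  assert (Hm : forall a b, maps (image (fun a => opair a (F a)) x) a b <-> a ∈ x /\ b = F a).
  { intros a b. rewrite maps_iff, Hf. split.
    - intros (a' & Ha & E). apply opair_inj in E. destruct E; now subst.
    - intros [Ha ->]. eauto. }
  split; [apply image_is_set|]. split; [|split].
  - intros u Hu. apply Hf in Hu. destruct Hu as (a & Ha & ->). exists a, (F a).
    rewrite is_opair_iff. split; [exact Ha|]. split; [now apply Hxy | reflexivity].
  - intros a Ha. exists (F a). split; [now apply Hm|]. intros b Hb. now apply Hm in Hb.
  - intros b Hb. destruct (Hyx b Hb) as [H E]. exists (G b). split; [now apply Hm|].
    intros a Ha. apply Hm in Ha. destruct Ha as [Ha ->]. now apply Hxy.
Qed.

Lemma equinumerous_elim x y : equinumerous x y -> exists F G, Fun1 any F /\ Fun1 any G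
  /\ (forall a, a ∈ x -> F a ∈ y /\ G (F a) = a)
  /\ (forall b, b ∈ y -> G b ∈ x /\ F (G b) = b).
Proof.
  intros (Hx & Hy & f & Hf & Hp & Hxy & Hyx).
  set (F a := iota (fun b => opair a b ∈ f)). set (G b := iota (fun a => opair a b ∈ f)).
  exists F, G.
  assert (HF : forall a b, opair a b ∈ f -> a ∈ x /\ b ∈ y /\ F a = b /\ G b = a).
  { intros a b H. destruct (Hp _ H) as (a' & b' & Ha & Hb & E).
    apply is_opair_iff, opair_inj in E. destruct E as [-> ->].
    split; [exact Ha|]. split; [exact Hb|].
    destruct (Hxy a' Ha) as (b & _ & Ub). destruct (Hyx b' Hb) as (a & _ & Ua).
    split; apply iota_eq; auto; intros c Hc.
    - rewrite <- (Ub c), <- (Ub b'); try apply maps_iff; auto.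
    - rewrite <- (Ua c), <- (Ua a'); try apply maps_iff; auto. }
  split; [unfold F; def|]. split; [unfold G; def|]. split.
  - intros a Ha. destruct (Hxy a Ha) as (b & Hb & _). apply maps_iff in Hb.
    destruct (HF a b Hb) as (_ & ? & -> & ?). auto.
  - intros b Hb. destruct (Hyx b Hb) as (a & Ha & _). apply maps_iff in Ha.
    destruct (HF a b Ha) as (? & _ & ? & ->). auto.
Qed.

Lemma equinumerous_image F x : Fun1 any F -> is_set x ->
  (forall a b, a ∈ x -> b ∈ x -> F a = F b -> a = b) -> equinumerous x (image F x).
Proof.
  intros HF Hx Hinj.
  apply (equinumerous_intro F (fun b => iota (fun a => a ∈ x /\ F a = b)));
    [exact HF | exact Hx | apply image_is_set | |].
  - intros a Ha. split; [apply mem_image; eauto|].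
    apply iota_eq; [auto|]. intros c [Hc E]. auto.
  - intros b Hb. apply mem_image in Hb; [|exact HF]. destruct Hb as (a & Ha & ->).
    replace (iota _) with a; [auto|]. symmetry.
    apply iota_eq; [auto|]. intros c [Hc E]. auto.
Qed.

Lemma equinumerous_sym x y : equinumerous x y -> equinumerous y x.
Proof.
  intros H. destruct (equinumerous_elim x y H) as (F & G & HF & HG & Hxy & Hyx).
  destruct H as (Hx & Hy & _). now apply (equinumerous_intro G F).
Qed.

Lemma equinumerous_trans x y z : equinumerous x y -> equinumerous y z -> equinumerous x z.
Proof.
  intros H H'. destruct (equinumerous_elim x y H) as (F & G & HF & HG & Hxy & Hyx).
  destruct (equinumerous_elim y z H') as (F' & G' & HF' & HG' & Hyz & Hzy).
  destruct H as (Hx & _), H' as (_ & Hz & _).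
  apply (equinumerous_intro (fun a => F' (F a)) (fun c => G (G' c))); [def | exact Hx | exact Hz | |].
  - intros a Ha. destruct (Hxy a Ha) as [Hb E]. destruct (Hyz _ Hb) as [Hc E'].
    split; [exact Hc|]. now rewrite E'.
  - intros c Hc. destruct (Hzy c Hc) as [Hb E]. destruct (Hyx _ Hb) as [Ha E'].
    split; [exact Ha|]. now rewrite E'.
Qed.

Lemma Def2_equinumerous C : Def2 C equinumerous.
Proof.
  unfold equinumerous, bijection, unique, maps, is_opair, is_upair. def.
Qed.
Hint Resolve Def2_equinumerous : def.

(** * Automorphisms *)

Record automorphism (f : M -> M) : Prop := {
  aut_def : Fun1 any f;
  aut_surj : forall y, exists x, f x = y;
  aut_inj : forall x y, f x = f y -> x = y;
  aut_mem : forall x y, f x ∈ f y <-> x ∈ y;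
  aut_ur : forall x, ur (f x) <-> ur x
}.

Lemma aut_sat f : automorphism f ->
  forall phi rho, sat (fun i => f (rho i)) phi <-> sat rho phi.
Proof. intros []. now apply sat_automorphism. Qed.

Lemma aut_comp f g : automorphism f -> automorphism g -> automorphism (fun x => g (f x)).
Proof.
  intros [Hf1 Hf2 Hf3 Hf4 Hf5] [Hg1 Hg2 Hg3 Hg4 Hg5]. split.
  - def.
  - intros z. destruct (Hg2 z) as [y <-], (Hf2 y) as [x <-]. eauto.
  - auto.
  - intros x y. now rewrite Hg4, Hf4.
  - intros x. now rewrite Hg5, Hf5.
Qed.

Lemma aut_mem_iff f x z : automorphism f -> (z ∈ f x <-> exists y, y ∈ x /\ z = f y).
Proof.
  intros [_ Hs _ Hm _]. split.
  - intros H. destruct (Hs z) as [y <-]. exists y. split; [now apply Hm | reflexivity].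
  - intros (y & Hy & ->). now apply Hm.
Qed.

Lemma aut_is_set f x : automorphism f -> (is_set (f x) <-> is_set x).
Proof. intros []. unfold is_set. now rewrite aut_ur0. Qed.

Lemma aut_fix f : automorphism f ->
  forall x, (forall u, u ∈ support x -> f u = u) -> f x = x.
Proof.
  intros Hf. pose proof (aut_def f Hf).
  apply (mem_ind (fun x => (forall u, u ∈ support x -> f u = u) -> f x = x)); [def|].
  intros x IH Hx. destruct (classic (ur x)) as [Hu|Hs].
  - apply Hx, mem_support. auto.
  - assert (Hy : forall y, y ∈ x -> f y = y)
      by (intros y Hy; apply IH; [exact Hy|]; intros u Hu; apply Hx, (support_mem x y Hy u Hu)).
    apply set_ext; [now apply aut_is_set | exact Hs|].
    intros z. rewrite aut_mem_iff by exact Hf. split.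
    + intros (y & Hyx & ->). now rewrite Hy.
    + intros Hz. exists z. split; [exact Hz|]. now rewrite Hy.
Qed.

Lemma aut_equinumerous f x : automorphism f -> is_set x -> equinumerous x (f x).
Proof.
  intros Hf Hx. replace (f x) with (image f x).
  - apply equinumerous_image; [apply Hf | exact Hx|]. intros a b _ _. apply Hf.
  - apply set_ext; [apply image_is_set | now apply aut_is_set|].
    intros z. rewrite (aut_mem_iff f x) by exact Hf. apply mem_image, Hf.
Qed.

Lemma aut_Def f C F : automorphism f -> (forall c, C c -> f c = c) -> Def C F ->
  forall e, F (fun i => f (e i)) <-> F e.
Proof. intros Hf. apply Def_equivariant, aut_sat, Hf. Qed.

Lemma aut_Fun1 f g : automorphism f -> Fun1 (fun _ => False) g -> forall x, g (f x) = f (g x).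
Proof.
  intros Hf Hg x. apply (DefT_equivariant _ _ f (aut_sat f Hf)
    (fun c (H : False) => match H with end) Hg (fun _ => x)).
Qed.

Lemma aut_support f x z : automorphism f ->
  (z ∈ support (f x) <-> exists u, u ∈ support x /\ z = f u).
Proof.
  intros Hf. rewrite (aut_Fun1 f support Hf (Fun1_support _)). now apply aut_mem_iff.
Qed.

Lemma aut_rank f x : automorphism f -> rank (f x) = rank x.
Proof.
  intros Hf. rewrite (aut_Fun1 f rank Hf (Fun1_rank _)). apply aut_fix; [exact Hf|].
  intros u Hu. destruct (support_rank x u Hu).
Qed.

Definition permute_step (s : M -> M) x S : M :=
  iota (fun v => (ur x /\ v = s x) \/ (is_set x /\ v = S)).

Definition permute s : M -> M := mem_rec (permute_step s).

(** Involutions suffice for what follows, and for them the extension is its own inverse,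
    so that it is bijective. *)
Lemma permute_automorphism s : Fun1 any s ->
  (forall u, ur u -> ur (s u) /\ s (s u) = u) ->
  automorphism (permute s) /\ forall u, ur u -> permute s u = s u.
Proof.
  intros Hs Hinv.
  assert (Hd : Fun1 any (permute s)) by (apply Fun1_mem_rec; unfold permute_step; def).
  assert (E : forall x, permute s x = permute_step s x (image (permute s) x))
    by (apply mem_rec_eq; unfold permute_step; def).
  assert (Eu : forall u, ur u -> permute s u = s u).
  { intros u Hu. rewrite E. apply iota_eq; [auto|]. intros v [[_ ->]|[H _]]; [reflexivity|].
    contradiction. }
  assert (Es : forall x, is_set x -> permute s x = image (permute s) x).
  { intros x Hx. rewrite E. apply iota_eq; [auto|]. intros v [[H _]|[_ ->]]; [|reflexivity].
    contradiction. }
  assert (Hur : forall x, ur (permute s x) <-> ur x).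
  { intros x. destruct (classic (ur x)) as [Hu|Hx].
    - rewrite Eu by exact Hu. split; [auto|]. intros _. now apply Hinv.
    - rewrite Es by exact Hx. split; [|contradiction].
      intros H. destruct (image_is_set _ _ H). }
  assert (Hmem : forall x z, z ∈ permute s x <-> exists y, y ∈ x /\ z = permute s y).
  { intros x z. destruct (classic (ur x)) as [Hu|Hx].
    - split; [intros H; apply Hur in Hu; destruct (ur_no_mem _ _ Hu H)|].
      intros (y & Hy & _). destruct (ur_no_mem _ _ Hu Hy).
    - rewrite Es by exact Hx. now apply mem_image. }
  assert (Hpp : forall x, permute s (permute s x) = x).
  { apply (mem_ind (fun x => permute s (permute s x) = x)); [def|]. intros x IH.
    destruct (classic (ur x)) as [Hu|Hx].
    - rewrite (Eu x), Eu; try apply Hinv; exact Hu.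
    - apply set_ext; [|exact Hx|].
      + unfold is_set. now rewrite !Hur.
      + intros z. rewrite Hmem. split.
        * intros (y & Hy & ->). apply Hmem in Hy. destruct Hy as (y' & Hy & ->).
          now rewrite IH.
        * intros Hz. exists (permute s z). split; [|now rewrite IH]. apply Hmem. eauto. }
  assert (Hinj : forall x y, permute s x = permute s y -> x = y).
  { intros x y H. now rewrite <- (Hpp x), H. }
  split; [|exact Eu]. split; auto.
  - intros y. exists (permute s y). apply Hpp.
  - intros x y. rewrite Hmem. split; [|eauto]. intros (z & Hz & H). apply Hinj in H. now subst.
Qed.

Lemma aut_swap A B : (forall a, a ∈ A -> ur a) -> (forall b, b ∈ B -> ur b) ->
  (forall a, a ∈ A -> ~ a ∈ B) -> equinumerous A B ->
  exists f, automorphism f /\ f A = B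
  /\ forall u, ur u -> ~ u ∈ A -> ~ u ∈ B -> f u = u.
Proof.
  intros HA HB Hdis HAB.
  destruct (equinumerous_elim A B HAB) as (F & G & HF & HG & H1 & H2).
  set (s u := iota (fun v => (u ∈ A /\ v = F u) \/ (u ∈ B /\ v = G u)
                             \/ (~ u ∈ A /\ ~ u ∈ B /\ v = u))).
  assert (sA : forall u, u ∈ A -> s u = F u).
  { intros u Hu. apply iota_eq; [auto|]. intros v Hv. specialize (Hdis u Hu). tauto. }
  assert (sB : forall u, u ∈ B -> s u = G u).
  { intros u Hu. apply iota_eq; [auto|]. intros v Hv.
    assert (~ u ∈ A) by (intros Hu'; exact (Hdis u Hu' Hu)). tauto. }
  assert (sO : forall u, ~ u ∈ A -> ~ u ∈ B -> s u = u).
  { intros u Hu Hu'. apply iota_eq; [auto|]. intros v Hv. tauto. }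
  destruct (permute_automorphism s) as [Hf Hfs].
  - unfold s. def.
  - intros u Hu. destruct (classic (u ∈ A)) as [HuA|HuA]; [|destruct (classic (u ∈ B)) as [HuB|HuB]].
    + rewrite (sA u HuA). destruct (H1 u HuA) as [Hb E]. now rewrite (sB _ Hb), E; auto.
    + rewrite (sB u HuB). destruct (H2 u HuB) as [Ha E]. now rewrite (sA _ Ha), E; auto.
    + now rewrite !sO.
  - exists (permute s). split; [exact Hf|]. split.
    + apply set_ext; [apply aut_is_set; [exact Hf | apply HAB] | apply HAB|].
      intros z. rewrite aut_mem_iff by exact Hf. split.
      * intros (a & Ha & ->). rewrite Hfs, sA by auto. now apply H1.
      * intros Hz. destruct (H2 z Hz) as [Ha E]. exists (G z). split; [exact Ha|].
        now rewrite Hfs, sA, E by auto.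
    + intros u Hu HuA HuB. now rewrite Hfs, sO by assumption.
Qed.

(** * Consequences of Plenitude *)

Hypothesis Hplen : plenitude_plus M.

Lemma small_image2 (F : M -> M -> M) x y : Fun2 any F ->
  small (fun z => exists a b, a ∈ x /\ b ∈ y /\ z = F a b).
Proof.
  intros HF. set (g b := setof (fun z => exists a, a ∈ x /\ z = F a b)).
  assert (Hg : Fun1 any g) by (unfold g; def).
  apply small_sub with (fun z => exists u, u ∈ image g y /\ z ∈ u); [|apply small_union].
  intros z (a & b & Ha & Hb & ->). exists (g b). split; [apply mem_image; eauto|].
  apply (mem_setof (fun z => exists a, a ∈ x /\ z = F a b)); [def | | eauto].
  apply (small_image (fun a => F a b)). def.
Qed.

(** A set of urelements equinumerous with the product of [s] and the power set of [B] has
    one slice for each subset of [B].  If all of them met [B], then a subset of [B] would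
    be mapped onto the power set of [B], against Cantor's theorem. *)
Lemma fresh_copy s B : is_set s -> exists A, is_set A /\ (forall a, a ∈ A -> ur a)
  /\ equinumerous s A /\ forall a, a ∈ A -> ~ a ∈ B.
Proof.
  intros Hs.
  set (T := setof (fun z => exists a w, a ∈ s /\ w ∈ power B /\ z = opair a w)).
  assert (HT : forall a w, a ∈ s -> w ∈ power B -> opair a w ∈ T).
  { intros a w Ha Hw. apply mem_setof; [def | apply small_image2; def | eauto]. }
  destruct (Hplen T) as (E & HE & HEu & HTE); [apply setof_is_set|].
  destruct (equinumerous_elim T E HTE) as (F & G & HF & HG & HFG & _).
  destruct (classic (exists w, w ∈ power B /\ forall a, a ∈ s -> ~ F (opair a w) ∈ B))
    as [(w & Hw & Hdis)|N].
  - exists (image (fun a => F (opair a w)) s).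
    assert (Hm : forall y, y ∈ image (fun a => F (opair a w)) s <-> exists a, a ∈ s /\ y = F (opair a w))
      by (apply mem_image; def).
    split; [apply image_is_set|]. split; [|split].
    + intros y Hy. apply Hm in Hy. destruct Hy as (a & Ha & ->). apply HEu, HFG, HT; assumption.
    + apply equinumerous_image; [def | exact Hs|]. intros a b Ha Hb Eq.
      destruct (HFG _ (HT a w Ha Hw)) as [_ Ea], (HFG _ (HT b w Hb Hw)) as [_ Eb].
      rewrite Eq, Eb in Ea. now apply opair_inj in Ea.
    + intros y Hy. apply Hm in Hy. destruct Hy as (a & Ha & ->). auto.
  - exfalso.
    set (d := setof (fun b => b ∈ B /\ exists a w, a ∈ s /\ w ∈ power B /\ b = F (opair a w) /\ ~ b ∈ w)).
    assert (Hd : forall b, b ∈ d <-> b ∈ B /\ exists a w, a ∈ s /\ w ∈ power B /\ b = F (opair a w) /\ ~ b ∈ w).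
    { apply mem_setof; [def|]. eapply small_sub; [|apply (small_mem B)]. now intros z []. }
    assert (HdB : d ∈ power B).
    { apply mem_power. split; [apply setof_is_set|]. intros b Hb. now apply Hd in Hb. }
    apply N. exists d. split; [exact HdB|]. intros a Ha HaB.
    assert (H : ~ F (opair a d) ∈ d).
    { intros H. pose proof H as H'. apply Hd in H'. destruct H' as (_ & a' & w & Ha' & Hw & Eq & Hn).
      destruct (HFG _ (HT a d Ha HdB)) as [_ E1], (HFG _ (HT a' w Ha' Hw)) as [_ E2].
      rewrite Eq, E2 in E1. apply opair_inj in E1. destruct E1 as [-> ->]. contradiction. }
    apply H, Hd. split; [exact HaB|]. exists a, d. auto.
Qed.

Lemma fresh_urelement B : exists u, ur u /\ ~ u ∈ B.
Proof.
  destruct (fresh_copy (upair B B) B) as (A & HA & HAu & HE & Hdis); [apply upair_is_set|].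
  destruct (equinumerous_elim _ _ HE) as (F & G & _ & _ & H & _).
  destruct (H B) as [Hu _]; [apply mem_upair; auto|]. eauto.
Qed.

(** [A] and [B] may overlap, and then a bijection between them need not extend to a
    permutation of their union; so the first is moved to the second by way of a copy that is
    disjoint from both. *)
Lemma aut_move A B K : (forall a, a ∈ A -> ur a) -> (forall b, b ∈ B -> ur b) ->
  (forall a, a ∈ A -> ~ a ∈ K) -> (forall b, b ∈ B -> ~ b ∈ K) -> equinumerous A B ->
  exists f, automorphism f /\ f A = B /\ forall u, ur u -> u ∈ K -> f u = u.
Proof.
  intros HA HB HAK HBK HAB.
  destruct (fresh_copy A (cup K (cup A B))) as (C & HC & HCu & HAC & Hdis); [apply HAB|].
  assert (HCK : forall c, c ∈ C -> ~ c ∈ K /\ ~ c ∈ A /\ ~ c ∈ B).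
  { intros c Hc. specialize (Hdis c Hc). rewrite !mem_cup in Hdis. tauto. }
  destruct (aut_swap A C) as (f & Hf & Ef & Ff); auto.
  { intros a Ha Ha'. now apply HCK in Ha'. }
  destruct (aut_swap C B) as (g & Hg & Eg & Fg); auto.
  { intros a Ha. now apply HCK. }
  { eapply equinumerous_trans; [apply equinumerous_sym; exact HAC | exact HAB]. }
  exists (fun x => g (f x)). split; [now apply aut_comp|]. split; [now rewrite Ef, Eg|].
  intros u Hu HuK.
  assert (~ u ∈ A) by (intros H; exact (HAK u H HuK)).
  assert (~ u ∈ B) by (intros H'; exact (HBK u H' HuK)).
  assert (~ u ∈ C) by (intros H'; now apply HCK in H').
  rewrite Ff, Fg; auto.
Qed.

(** * Cardinals of bounded support *)

(** A cardinal is fixed by all automorphisms that fix the parameter, since these take a set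
    to an equinumerous one.  If its support had an urelement outside that of the parameter,
    then exchanging it with an urelement outside both would move the cardinal. *)
Lemma equinumerous_supported : cardinality_parametrically_representable M ->
  exists p, forall x, is_set x -> exists c, equinumerous x c /\ subset (support c) (support p).
Proof.
  intros (phi & p & Hex & Hiff & Heq). exists p. intros x Hx.
  destruct (Hex x Hx) as (c & Hc & _). exists c. split; [now apply Heq|].
  intros u Hu. apply NNPP. intros N.
  destruct (fresh_urelement (cup (support p) (support c))) as (v & Hv & Hvn).
  rewrite mem_cup in Hvn.
  destruct (aut_swap (upair u u) (upair v v)) as (f & Hf & Ef & Ff).
  - intros a Ha. apply mem_upair in Ha. assert (a = u) as -> by tauto. exact (support_ur c u Hu).
  - intros a Ha. apply mem_upair in Ha. now assert (a = v) as -> by tauto.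
  - intros a Ha Ha'. apply mem_upair in Ha, Ha'.
    assert (a = u) as -> by tauto. assert (u = v) as -> by tauto. tauto.
  - apply (equinumerous_intro (fun _ => v) (fun _ => u)); [def | apply upair_is_set.. | |];
      intros a Ha; rewrite !mem_upair in *; (split; [tauto|]); symmetry; tauto.
  - assert (Efu : f u = v).
    { assert (H : f u ∈ upair v v) by (rewrite <- Ef; apply Hf, mem_upair; auto).
      apply mem_upair in H. tauto. }
    assert (Efp : f p = p).
    { apply aut_fix; [exact Hf|]. intros z Hz. apply Ff.
      - exact (support_ur p z Hz).
      - rewrite mem_upair. intros [-> | ->]; exact (N Hz).
      - rewrite mem_upair. intros [-> | ->]; tauto. }
    assert (Hfc : card_graph M phi p (f x) (f c)).
    { unfold card_graph in *. rewrite <- (aut_sat f Hf) in Hc.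
      refine (proj1 (sat_ext M phi _ _ _) Hc). now intros [|[|i]]. }
    assert (E : c = f c).
    { apply (Hiff x (f x)); auto; [now apply aut_is_set | now apply aut_equinumerous]. }
    apply Hvn. right. rewrite E. apply aut_support; [exact Hf|]. eauto.
Qed.

(** * Bounding the witnesses *)

Definition prepend (n : nat) (rho r : nat -> M) (i : nat) : M :=
  if Nat.ltb i n then rho i else r (i - n).

Lemma prepend_lt n rho r i : i < n -> prepend n rho r i = rho i.
Proof. intros H. unfold prepend. now rewrite (proj2 (PeanoNat.Nat.ltb_lt i n) H). Qed.

Lemma prepend_0 rho r : prepend 0 rho r = r.
Proof. apply functional_extensionality. intros i. unfold prepend. cbn. now rewrite PeanoNat.Nat.sub_0_r. Qed.

Lemma prepend_S n rho rho' r : (forall i, i < n -> rho i = rho' i) ->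
  prepend (S n) rho r = prepend n rho' (scons (rho n) r).
Proof.
  intros H. apply functional_extensionality. intros i. unfold prepend.
  destruct (PeanoNat.Nat.ltb_spec i (S n)), (PeanoNat.Nat.ltb_spec i n); try lia.
  - auto.
  - replace i with n by lia. now rewrite PeanoNat.Nat.sub_diag.
  - now replace (i - n) with (S (i - S n)) by lia.
Qed.

Lemma all_prepend_S n T r (P : (nat -> M) -> Prop) :
  (forall rho, (forall i, i < S n -> rho i ∈ T) -> P (prepend (S n) rho r))
  <-> forall a, a ∈ T -> forall rho, (forall i, i < n -> rho i ∈ T) -> P (prepend n rho (scons a r)).
Proof.
  split.
  - intros H a Ha rho Hrho.
    set (rho' i := if Nat.eqb i n then a else rho i).
    assert (En : rho' n = a) by (unfold rho'; now rewrite PeanoNat.Nat.eqb_refl).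
    assert (E : forall i, i < n -> rho' i = rho i).
    { intros i Hi. unfold rho'. destruct (PeanoNat.Nat.eqb_spec i n); [lia | reflexivity]. }
    rewrite <- En, <- (prepend_S n rho' rho r E). apply H. intros i Hi.
    destruct (PeanoNat.Nat.eq_dec i n) as [->|]; [now rewrite En|].
    rewrite E by lia. apply Hrho. lia.
  - intros H rho Hrho. rewrite (prepend_S n rho rho) by auto. apply H; auto.
Qed.

Section Environments.
Variables (C : M -> Prop) (P : (nat -> M) -> M -> M -> Prop).

Definition Def_env : Prop :=
  forall (s : nat -> (nat -> M) -> M) (a b : (nat -> M) -> M), (forall i, DefT C (s i)) -> DefT C a -> DefT C b ->
  Def C (fun e => P (fun i => s i e) (a e) (b e)).

Hypothesis HP : Def_env.

(** A formula has only finitely many free variables, so that quantifying over their values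
    is a finite iteration of quantifiers over [T]. *)
Lemma Def_all_prepend n :
  forall (s : nat -> (nat -> M) -> M) (a b T : (nat -> M) -> M), (forall i, DefT C (s i)) -> DefT C a -> DefT C b ->
  DefT C T -> Def C (fun e => forall rho, (forall i, i < n -> rho i ∈ T e) ->
                     P (prepend n rho (fun i => s i e)) (a e) (b e)).
Proof.
  induction n as [|n IH]; intros s a b T Hs Ha Hb HT.
  - refine (Def_iff C _ _ _ (HP s a b Hs Ha Hb)). intros e. split.
    + intros H rho _. now rewrite prepend_0.
    + intros H. specialize (H (fun _ => a e)). rewrite prepend_0 in H. apply H. lia.
  - apply Def_iff with (fun e => forall x, x ∈ T e -> forall rho, (forall i, i < n -> rho i ∈ T e) ->
        P (prepend n rho (scons x (fun i => s i e))) (a e) (b e)).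
    { intros e. now rewrite (all_prepend_S n (T e) (fun i => s i e) (fun r => P r (a e) (b e))). }
    apply (Def_all C (fun x e => x ∈ T e -> forall rho, (forall i, i < n -> rho i ∈ T e) ->
        P (prepend n rho (scons x (fun i => s i e))) (a e) (b e))).
    apply DefT_tail in Ha, Hb, HT.
    apply Def_imp; [apply Def2_app; [apply Def2_mem | apply DefT_var | exact HT]|].
    refine (Def_iff C _ _ _ (IH (fun i => match i with 0 => fun e => e 0 | S i => fun e => s i (tail e) end)
      _ _ _ _ Ha Hb HT)).
    + intros e. replace (scons (e 0) (fun i => s i (tail e))) with
        (fun i => match i with 0 => fun e => e 0 | S i => fun e => s i (tail e) end e); [reflexivity|].
      apply functional_extensionality. now intros [|i].
    + intros [|i]; [apply DefT_var | apply DefT_tail, Hs].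
Qed.

End Environments.

Lemma env_bounding (P : (nat -> M) -> M -> M -> Prop) T c n : Def_env any P ->
  (forall r b b', P r c b -> rank_le b b' -> P r c b') ->
  (forall r, exists b, P r c b) ->
  forall r, exists b, forall rho, (forall i, i < n -> rho i ∈ T) -> P (prepend n rho r) c b.
Proof.
  intros HP Hup Hex. induction n as [|n IH]; intros r.
  - destruct (Hex r) as [b Hb]. exists b. intros rho _. now rewrite prepend_0.
  - destruct (rank_bounding (fun a b => forall rho, (forall i, i < n -> rho i ∈ T) ->
      P (prepend n rho (scons a r)) c b) T) as [b Hb].
    + refine (Def_iff any _ _ _ (Def_all_prepend any P HP n
        (fun i => match i with 0 => fun e => e 0 | S i => fun e => r i end)
        (fun _ => c) (fun e => e 1) (fun _ => T) _ _ _ _)).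
      * intros e. replace (scons (e 0) r) with
          (fun i => match i with 0 => fun e => e 0 | S i => fun e => r i end e); [reflexivity|].
        apply functional_extensionality. now intros [|i].
      * intros [|i]; [apply DefT_var | now apply DefT_const].
      * now apply DefT_const.
      * apply DefT_var.
      * now apply DefT_const.
    + intros a b b' H Hle rho Hrho. eauto.
    + intros a _. apply IH.
    + exists b. apply (all_prepend_S n T r (fun r => P r c b)). exact Hb.
Qed.

Fixpoint fv_bound (phi : formula) : nat :=
  match phi with
  | fMem i j | fEq i j => S (max i j)
  | fUr i => S i
  | fNot phi => fv_bound phi
  | fAnd phi psi => max (fv_bound phi) (fv_bound psi)
  | fEx phi => pred (fv_bound phi)
  end.

Lemma free_fv_bound phi : forall i, free i phi -> i < fv_bound phi.
Proof.
  induction phi as [i j | i j | i | phi IH | phi1 IH1 phi2 IH2 | phi IH];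
    cbn; intros k H; auto; try lia.
  - destruct H as [H|H]; [apply IH1 in H | apply IH2 in H]; lia.
  - apply IH in H. lia.
Qed.

Definition new_urelements K E y : M :=
  setof (fun u => u ∈ support y /\ ~ u ∈ K /\ ~ u ∈ E).

Lemma mem_new_urelements K E y u :
  u ∈ new_urelements K E y <-> u ∈ support y /\ ~ u ∈ K /\ ~ u ∈ E.
Proof.
  apply (mem_setof (fun u => u ∈ support y /\ ~ u ∈ K /\ ~ u ∈ E)); [def|].
  apply small_sub with (fun u => u ∈ support y); [tauto | apply small_mem].
Qed.

Lemma Fun3_new_urelements C : Fun3 C new_urelements.
Proof. unfold new_urelements. def. Qed.
Hint Resolve Fun3_new_urelements : def.

(** Only the rank of [y] and the number of its new urelements are bounded: up to an
    automorphism that fixes [K] and [E], nothing else about the new urelements matters. *)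
Definition bounded K E b y : Prop :=
  rank_le y b /\ exists d, subset (support d) K /\ rank_le d b
                          /\ equinumerous d (new_urelements K E y).

Lemma Def4_bounded C : Def4 C bounded.
Proof. unfold bounded. def. Qed.
Hint Resolve Def4_bounded : def.

Lemma bounded_le K E b b' y : bounded K E b y -> rank_le b b' -> bounded K E b' y.
Proof.
  intros [H (d & Hd & Hd' & Hd2)] Hle. split; [now apply rank_le_trans with b|].
  exists d. split; [exact Hd|]. split; [now apply rank_le_trans with b | exact Hd2].
Qed.

Definition witness psi K (rho : nat -> M) E b : Prop :=
  (exists y, sat (scons y rho) psi) -> exists y, sat (scons y rho) psi /\ bounded K E b y.

Lemma Def_witness C psi K : C K -> Def_env C (witness psi K).
Proof.
  intros HK s a b Hs Ha Hb. unfold witness.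
  assert (Hsat : Def C (fun e => sat (scons (e 0) (fun i => s i (tail e))) psi)).
  { refine (Def_iff C _ _ _ (Def_sat C psi (fun i =>
      match i with 0 => fun e => e 0 | S i => fun e => s i (tail e) end) _)).
    - intros e. apply sat_ext. now intros [|i].
    - intros [|i]; [apply DefT_var | apply DefT_tail, Hs]. }
  apply Def_imp; apply Def_ex; [exact Hsat|]. apply Def_and; [exact Hsat|].
  apply (Def4_app C bounded (fun _ => K) (fun e => a (tail e)) (fun e => b (tail e)) (fun e => e 0));
    [def_leaf | now apply DefT_const | now apply DefT_tail.. | apply DefT_var].
Qed.

Definition witnesses psi K E a b : Prop :=
  forall rho, (forall i, i < fv_bound (fEx psi) -> rho i ∈ stage (cup K E) a) ->
  witness psi K (prepend (fv_bound (fEx psi)) rho (fun _ => K)) E b.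

Lemma Def3_witnesses C psi K : C K -> Def3 C (fun E a b => witnesses psi K E a b).
Proof.
  intros HK.
  apply (Def_all_prepend C _ (Def_witness C psi K HK) _ (fun _ _ => K) (fun e => e 0)
    (fun e => e 2) (fun e => stage (cup K (e 0)) (e 1))); [|def..]; auto.
  intros _. now apply DefT_const.
Qed.

Section Absorption.
Variable K : M.
Hypothesis Hcard : forall x, is_set x -> exists c, equinumerous x c /\ subset (support c) K.

(** All sets [E] of urelements disjoint from [K] and equinumerous with [stage K a] are
    conjugate over [K], so that it does not matter which one is taken. *)
Definition absorbs psi a b : Prop :=
  exists E, (forall u, u ∈ E -> ur u /\ ~ u ∈ K) /\ equinumerous (stage K a) E
  /\ witnesses psi K E a b.

Lemma Def2_absorbs psi : Def2 any (absorbs psi).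
Proof. pose proof (Def3_witnesses any psi K I). unfold absorbs. def. Qed.

Lemma absorbs_le psi a b b' : absorbs psi a b -> rank_le b b' -> absorbs psi a b'.
Proof.
  intros (E & HE & HEa & H) Hle. exists E. split; [exact HE|]. split; [exact HEa|].
  intros rho Hrho Hy. destruct (H rho Hrho Hy) as (y & Hys & Hyb). exists y.
  split; [exact Hys|]. eapply bounded_le; eauto.
Qed.

Lemma absorbs_total psi a : exists b, absorbs psi a b.
Proof.
  destruct (fresh_copy (stage K a) K) as (E & HE & HEu & HEa & Hdis); [apply stage_is_set|].
  destruct (env_bounding (witness psi K) (stage (cup K E) a) E (fv_bound (fEx psi))
    (Def_witness any psi K I)) with (r := fun _ : nat => K) as [b Hb].
  - intros r b b' H Hle Hy. destruct (H Hy) as (y & Hys & Hyb). exists y.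
    split; [exact Hys|]. eapply bounded_le; eauto.
  - intros r. destruct (classic (exists y, sat (scons y r) psi)) as [[y Hy]|N].
    + destruct (Hcard (new_urelements K E y)) as (d & Hd & Hds); [apply setof_is_set|].
      exists (upair y d). intros _. exists y. split; [exact Hy|].
      split; [apply rank_le_mem, mem_upair; auto|]. exists d. split; [exact Hds|].
      split; [apply rank_le_mem, mem_upair; auto | now apply equinumerous_sym].
    + exists K. now intros H.
  - exists b, E. split; [auto|]. split; [exact HEa|]. exact Hb.
Qed.

End Absorption.

Fixpoint all_ex (R : formula -> Prop) (phi : formula) : Prop :=
  match phi with
  | fNot phi => all_ex R phi
  | fAnd phi psi => all_ex R phi /\ all_ex R psi
  | fEx phi => R phi /\ all_ex R phi
  | _ => True
  end.

Lemma all_ex_impl (R R' : formula -> Prop) phi :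
  (forall psi, R psi -> R' psi) -> all_ex R phi -> all_ex R' phi.
Proof. intros H. induction phi; cbn; intuition. Qed.

Lemma all_ex_Def2 (R : formula -> M -> M -> Prop) phi :
  (forall psi, Def2 any (R psi)) -> Def2 any (fun a b => all_ex (fun psi => R psi a b) phi).
Proof.
  intros HR. unfold Def2. induction phi; cbn; try apply Def_const.
  - exact IHphi.
  - now apply Def_and.
  - apply Def_and; [apply HR | exact IHphi].
Qed.

Lemma all_ex_total (R : formula -> M -> M -> Prop) phi a :
  (forall psi b b', R psi a b -> rank_le b b' -> R psi a b') ->
  (forall psi, exists b, R psi a b) -> exists b, all_ex (fun psi => R psi a b) phi.
Proof.
  intros Hup Hex.
  assert (Hup' : forall psi b b', all_ex (fun psi => R psi a b) psi -> rank_le b b' ->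
    all_ex (fun psi => R psi a b') psi)
    by (intros psi b b' H Hle; revert H; apply all_ex_impl; eauto).
  assert (Hjoin : forall b c, rank_le b (upair b c) /\ rank_le c (upair b c))
    by (intros b c; split; apply rank_le_mem, mem_upair; auto).
  induction phi as [i j | i j | i | phi IH | phi1 [b1 IH1] phi2 [b2 IH2] | phi [b IH]]; cbn;
    try (now exists a); auto.
  - exists (upair b1 b2). split; eapply Hup'; eauto; apply Hjoin.
  - destruct (Hex phi) as [c Hc]. exists (upair b c).
    split; [eapply Hup | eapply Hup']; eauto; apply Hjoin.
Qed.

(** * A closed chain of ranks *)

(** By recursion on membership each object [x] gets the least rank that is related to all
    the ranks given to the members of [x].  A set closed under y ↦ y ∪ {y} then gives a set
    of ranks in which each has a successor, without any natural numbers. *)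
Lemma closed_chain (B : M -> M -> Prop) x0 : Def2 any B ->
  (forall a b b', B a b -> rank_le b b' -> B a b') -> (forall a, exists b, B a b) ->
  exists L, (exists a, a ∈ L) /\ forall a, a ∈ L ->
    (exists y, a = rank y) /\ rank_le x0 a /\ exists b, b ∈ L /\ rank_lt a b /\ B a b.
Proof.
  intros HB Hup Hex.
  set (good S v := rank_le x0 v /\ forall a, a ∈ S -> rank_lt a v /\ B a v).
  assert (Hgood : Def2 any good) by (unfold good; def).
  set (step (x S : M) := least_rank (good S)).
  assert (Hstep : Fun2 any step) by (unfold step, least_rank; def).
  assert (Hg : forall S, good S (least_rank (good S)) /\ exists y, least_rank (good S) = rank y).
  { intros S. apply least_rank_spec.
    - def.
    - destruct (rank_bounding (fun a b => rank_lt a b /\ B a b) S) as [b Hb].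
      + def.
      + intros a b b' [H1 H2] Hle. split; [now apply rank_lt_le_trans with b | eauto].
      + intros a _. destruct (Hex a) as [b Hb]. exists (upair a b). split.
        * apply rank_lt_mem, mem_upair. auto.
        * apply (Hup a b); [exact Hb|]. apply rank_le_mem, mem_upair. auto.
      + exists (upair x0 b).
        assert (Hle : rank_le b (upair x0 b)) by (apply rank_le_mem, mem_upair; auto).
        split; [apply rank_le_mem, mem_upair; auto|]. intros a Ha.
        destruct (Hb a Ha) as [H1 H2]. split; [now apply rank_lt_le_trans with b | eauto].
    - intros b b' [H1 H2] Hle. split; [now apply rank_le_trans with b|]. intros a Ha.
      destruct (H2 a Ha). split; [now apply rank_lt_le_trans with b | eauto]. }
  set (h := mem_rec step).
  assert (Hh : Fun1 any h) by (now apply Fun1_mem_rec).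
  assert (E : forall x, h x = least_rank (good (image h x)))
    by (intros x; exact (mem_rec_eq step Hstep x)).
  destruct (ZFU_infinity _ hZFU) as (w & Hw & (e & Hew & He & _) & Hsucc).
  assert (HL : forall z, z ∈ setof (fun z => exists y, (y ∈ w /\ is_set y) /\ z = h y)
    <-> exists y, (y ∈ w /\ is_set y) /\ z = h y).
  { apply mem_setof; [def|]. apply small_sub with (fun z => exists y, y ∈ w /\ z = h y).
    - intros z (y & [Hy _] & ->). eauto.
    - now apply small_image. }
  exists (setof (fun z => exists y, (y ∈ w /\ is_set y) /\ z = h y)).
  split; [exists (h e); apply HL; eauto|].
  intros a Ha. apply HL in Ha. destruct Ha as (n & [Hn Hns] & ->).
  destruct (Hg (image h n)) as [[H1 _] H2]. rewrite <- E in H1, H2.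
  split; [exact H2|]. split; [exact H1|].
  destruct (Hsucc n Hn Hns) as (n' & Hn' & Hns' & Hnn').
  exists (h n'). split; [apply HL; eauto|].
  destruct (Hg (image h n')) as [[_ H3] _]. rewrite <- E in H3.
  apply H3, mem_image; [exact Hh|]. exists n. split; [|reflexivity]. apply Hnn'. auto.
Qed.

(** * Reflection *)

(** The Tarski-Vaught test.  The variable [k] that denotes [T] moves up under each
    quantifier, so the claim is made for all [k]. *)
Lemma reflects_of_witnesses phi T : forall k (rho rho' : nat -> M),
  all_ex (fun psi => forall rho : nat -> M, (forall i, free i (fEx psi) -> rho i ∈ T) ->
    (exists y, sat (scons y rho) psi) -> exists y, y ∈ T /\ sat (scons y rho) psi) phi ->
  (forall i, rho' (shift k i) = rho i) -> rho' k = T ->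
  (forall i, free i phi -> rho i ∈ T) ->
  (sat rho phi <-> sat rho' (relativize k phi)).
Proof.
  induction phi as [i j | i j | i | phi IH | phi1 IH1 phi2 IH2 | phi IH];
    cbn; intros k rho rho' HT Hrho Hk Hfree.
  - now rewrite !Hrho.
  - now rewrite !Hrho.
  - now rewrite !Hrho.
  - rewrite (IH k rho rho'); auto. reflexivity.
  - rewrite (IH1 k rho rho'), (IH2 k rho rho'); try tauto; auto.
  - destruct HT as [Hex HT].
    assert (E : forall y, y ∈ T -> (sat (scons y rho) phi
      <-> sat (scons y rho') (relativize (S k) phi))).
    { intros y Hy. apply IH; [exact HT | | exact Hk |].
      - intros [|i]; cbn; auto.
      - intros [|i] Hi; cbn; auto. }
    split.
    + intros H. destruct (Hex rho Hfree H) as (y & Hy & Hs). exists y.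
      rewrite Hk. split; [exact Hy | now apply E].
    + intros (y & Hy & Hs). rewrite Hk in Hy. exists y. now apply E.
Qed.

Lemma support_of_urelements K : (forall u, u ∈ K -> ur u) -> is_set K -> subset (support K) K.
Proof.
  intros HK Hs u Hu. apply mem_support in Hu. destruct Hu as [[H _]|(y & Hy & Hu)]; [contradiction|].
  apply mem_support in Hu. destruct Hu as [[_ ->]|(z & Hz & _)]; [exact Hy|].
  destruct (ur_no_mem y z (HK y Hy) Hz).
Qed.

Section ReflectingSet.
Variables (K L A : M) (F : M -> M).
Hypothesis HK : forall u, u ∈ K -> ur u.
Hypothesis HKs : is_set K.
Hypothesis HF : Fun1 any F.
Hypothesis HFA : forall z, z ∈ stage K L -> ur (F z) /\ ~ F z ∈ K.
Hypothesis HFinj : forall z z', z ∈ stage K L -> z' ∈ stage K L -> F z = F z' -> z = z'.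
Hypothesis HLrank : forall a, a ∈ L -> exists y, a = rank y.

(** The embedding [F] of the whole [stage K L] makes the copies of the smaller stages
    increase with the rank, although nothing singles out one copy of each. *)
Let copy a : M := image F (stage K a).
Let layer a : M := stage (cup K (copy a)) a.
Let total : M := setof (fun z => exists a, a ∈ L /\ z ∈ layer a).

Lemma mem_copy a u : u ∈ copy a <-> exists z, z ∈ stage K a /\ u = F z.
Proof. now apply mem_image. Qed.

Lemma stage_le B a b : rank_le a b -> subset (stage B a) (stage B b).
Proof.
  intros H z Hz. apply mem_stage in Hz. destruct Hz as [H1 H2]. apply mem_stage.
  split; [exact H1 | now apply rank_le_trans with a].
Qed.

Lemma copy_le a b : rank_le a b -> subset (copy a) (copy b).
Proof.
  intros H u Hu. apply mem_copy in Hu. destruct Hu as (z & Hz & ->). apply mem_copy.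
  exists z. split; [exact (stage_le K a b H z Hz) | reflexivity].
Qed.

Lemma layer_le a b : rank_le a b -> subset (layer a) (layer b).
Proof.
  intros H z Hz. apply mem_stage in Hz. destruct Hz as [H1 H2]. apply mem_stage.
  split; [|now apply rank_le_trans with a]. intros u Hu. specialize (H1 u Hu).
  apply mem_cup in H1. apply mem_cup. destruct H1; [now left | right].
  now apply (copy_le a b H).
Qed.

Lemma mem_total z : z ∈ total <-> exists a, a ∈ L /\ z ∈ layer a.
Proof.
  assert (Hl : Fun1 any layer) by (unfold layer, copy, image; def).
  apply mem_setof; [def|].
  apply small_sub with (fun z => exists v, v ∈ image layer L /\ z ∈ v); [|apply small_union].
  intros u (a & Ha & Hu). exists (layer a). split; [apply mem_image; eauto | exact Hu].
Qed.

Lemma total_transitive : transitive_set total.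
Proof.
  split; [apply setof_is_set|]. intros y Hy z Hz. apply mem_total in Hy.
  destruct Hy as (a & Ha & Hy). apply mem_total. exists a. split; [exact Ha|].
  apply mem_stage in Hy. destruct Hy as [H1 H2]. apply mem_stage. split.
  - intros u Hu. apply H1, (support_mem y z Hz u Hu).
  - apply rank_le_trans with y; [now apply rank_le_mem | exact H2].
Qed.

Lemma common_layer rho n : (exists a, a ∈ L) -> (forall i, i < n -> rho i ∈ total) ->
  exists a, a ∈ L /\ forall i, i < n -> rho i ∈ layer a.
Proof.
  intros Hne. induction n as [|n IH]; intros H.
  - destruct Hne as [a Ha]. exists a. split; [exact Ha | lia].
  - destruct IH as (a & Ha & Hi); [auto|].
    destruct (proj1 (mem_total _) (H n ltac:(lia))) as (b & Hb & Hn).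
    assert (Hstep : forall c, rank_le a c -> rank_le b c -> forall i, i < S n -> rho i ∈ layer c).
    { intros c Hac Hbc i Hlt. destruct (PeanoNat.Nat.eq_dec i n) as [->|].
      - exact (layer_le b c Hbc _ Hn).
      - apply (layer_le a c Hac), Hi. lia. }
    destruct (rank_le_or_lt a b) as [Hle|Hlt].
    + exists b. split; [exact Hb|]. apply Hstep; [exact Hle | apply rank_le_refl].
    + exists a. split; [exact Ha|]. apply Hstep; [apply rank_le_refl | now apply rank_lt_le].
Qed.

Lemma aut_fix_pure f a : automorphism f -> a ∈ L -> f a = a.
Proof.
  intros Hf Ha. destruct (HLrank a Ha) as [y ->]. apply aut_fix; [exact Hf|].
  intros u Hu. destruct (support_rank y u Hu).
Qed.

(** The set of urelements in the definition of [absorbs] is conjugate to [copy a] over [K],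
    and the ranks [a] and [b] are pure sets, hence fixed by every automorphism. *)
Lemma witnesses_copy psi a b : a ∈ L -> b ∈ L -> absorbs K psi a b ->
  witnesses psi K (copy a) a b.
Proof.
  intros Ha Hb (E & HE & HEa & H).
  assert (HaL : subset (stage K a) (stage K L)) by (apply stage_le, rank_le_mem, Ha).
  assert (Hc : forall u, u ∈ copy a -> ur u /\ ~ u ∈ K).
  { intros u Hu. apply mem_copy in Hu. destruct Hu as (z & Hz & ->). auto. }
  destruct (aut_move E (copy a) K) as (f & Hf & EfE & FfK).
  - intros u Hu. now apply HE.
  - intros u Hu. now apply Hc.
  - intros u Hu. now apply HE.
  - intros u Hu. now apply Hc.
  - apply equinumerous_trans with (stage K a); [now apply equinumerous_sym|].
    apply equinumerous_image; [exact HF | apply stage_is_set|]. auto.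
  - assert (EfK : f K = K).
    { apply aut_fix; [exact Hf|]. intros u Hu. apply FfK; [exact (support_ur K u Hu)|].
      exact (support_of_urelements K HK HKs u Hu). }
    pose proof (aut_Def f (fun c => c = K) _ Hf (fun c E => eq_trans (f_equal f E) (eq_trans EfK (eq_sym E)))
      (Def3_witnesses (fun c => c = K) psi K eq_refl)
      (fun i => match i with 0 => E | 1 => a | _ => b end)) as Hinv.
    cbn in Hinv. rewrite EfE, (aut_fix_pure f a Hf Ha), (aut_fix_pure f b Hf Hb) in Hinv.
    now apply Hinv.
Qed.

(** If the new urelements of a witness are in bijection with [d], then they can be moved to
    the images of the pairs {z, a} with [z] in [d]: these pairs are in some later stage, but
    not in [stage K a] because their rank exceeds that of [a]. *)
Lemma bounded_witness_moves psi (rho : nat -> M) a b c y : a ∈ L -> b ∈ L -> c ∈ L ->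
  rank_lt a b -> rank_lt b c -> (forall i, free i (fEx psi) -> rho i ∈ layer a) ->
  sat (scons y rho) psi -> bounded K (copy a) b y ->
  exists y', y' ∈ layer c /\ sat (scons y' rho) psi.
Proof.
  intros Ha Hb Hc Hab Hbc Hrho Hy (Hyb & d & HdK & Hdb & Hdy).
  assert (Hpair : forall z, z ∈ d -> forall e, rank_le c e -> upair z a ∈ stage K e).
  { intros z Hz e Hce. apply mem_stage. split.
    - apply support_subset; [apply upair_is_set|]. intros x Hx. apply mem_upair in Hx.
      destruct Hx as [-> | ->].
      + intros u Hu. apply HdK, (support_mem d z Hz u Hu).
      + intros u Hu. destruct (HLrank a Ha) as [x ->]. destruct (support_rank x u Hu).
    - apply rank_le_trans with c; [|exact Hce]. apply rank_le_intro. intros x Hx.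
      apply mem_upair in Hx. apply rank_le_lt_trans with b; [|exact Hbc].
      destruct Hx as [-> | ->]; [|now apply rank_lt_le].
      apply rank_le_trans with d; [now apply rank_le_mem | exact Hdb]. }
  assert (HcL : rank_le c L) by (now apply rank_le_mem).
  assert (HaL : subset (stage K a) (stage K L)) by (apply stage_le, rank_le_mem, Ha).
  set (g z := F (upair z a)). assert (Hg : Fun1 any g) by (unfold g; def).
  assert (Hd' : forall u, u ∈ image g d <-> exists z, z ∈ d /\ u = F (upair z a)) by (now apply mem_image).
  set (N := new_urelements K (copy a) y) in *.
  destruct (aut_move N (image g d) (cup K (copy a))) as (f & Hf & EfN & Ff).
  - intros u Hu. apply mem_new_urelements in Hu. exact (support_ur y u (proj1 Hu)).
  - intros u Hu. apply Hd' in Hu. destruct Hu as (z & Hz & ->). now apply HFA, Hpair.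
  - intros u Hu. apply mem_new_urelements in Hu. rewrite mem_cup. tauto.
  - intros u Hu. apply Hd' in Hu. destruct Hu as (z & Hz & ->). rewrite mem_cup. intros [H|H].
    + revert H. now apply HFA, Hpair.
    + apply mem_copy in H. destruct H as (z' & Hz' & E).
      apply HFinj in E; [|now apply Hpair | now apply HaL]. subst z'.
      apply mem_stage in Hz'. destruct Hz' as [_ Hle]. apply (rank_lt_irrefl a).
      apply rank_lt_le_trans with (upair z a); [|exact Hle]. apply rank_lt_mem, mem_upair. auto.
  - apply equinumerous_trans with d; [now apply equinumerous_sym|].
    apply equinumerous_image; [exact Hg | apply Hdy|]. intros z z' Hz Hz' E.
    apply HFinj in E; try (now apply Hpair). apply upair_inj in E.
    destruct E as [[E _]|[-> E]]; congruence.
  - exists (f y). split.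
    + apply mem_stage. split.
      * intros u Hu. apply (aut_support f y u Hf) in Hu. destruct Hu as (v & Hv & ->).
        pose proof (support_ur y v Hv) as Hvu.
        destruct (classic (v ∈ cup K (copy a))) as [HvK|HvK].
        -- rewrite Ff by assumption. apply mem_cup in HvK. apply mem_cup.
           destruct HvK as [|HvK]; [now left | right].
           apply (copy_le a c); [|exact HvK]. apply rank_le_trans with b; now apply rank_lt_le.
        -- apply mem_cup. right.
           assert (HvN : f v ∈ f N).
           { apply Hf, mem_new_urelements. rewrite mem_cup in HvK. tauto. }
           rewrite EfN in HvN. apply Hd' in HvN. destruct HvN as (z & Hz & ->).
           apply mem_copy. exists (upair z a). split; [|reflexivity].
           apply Hpair; [exact Hz | apply rank_le_refl].
      * unfold rank_le. rewrite aut_rank by exact Hf.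
        apply rank_le_trans with b; [exact Hyb | now apply rank_lt_le].
    + apply (aut_sat f Hf psi) in Hy. refine (proj1 (sat_free_ext M psi _ _ _) Hy).
      intros [|i] Hi; cbn; [reflexivity|]. apply aut_fix; [exact Hf|]. intros u Hu.
      apply Ff; [exact (support_ur _ u Hu)|].
      specialize (Hrho i Hi). apply mem_stage in Hrho. now apply Hrho.
Qed.

Hypothesis HLne : exists a, a ∈ L.

Lemma total_has_witnesses psi :
  (forall a, a ∈ L -> exists b, b ∈ L /\ rank_lt a b /\ absorbs K psi a b) ->
  forall rho : nat -> M, (forall i, free i (fEx psi) -> rho i ∈ total) ->
  (exists y, sat (scons y rho) psi) -> exists y, y ∈ total /\ sat (scons y rho) psi.
Proof.
  intros HL rho Hrho [y Hy].
  set (n := fv_bound (fEx psi)).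
  destruct exists_empty as (o & Hos & Ho).
  assert (Hot : o ∈ total).
  { destruct HLne as [a Ha]. apply mem_total. exists a. split; [exact Ha|]. apply mem_stage.
    split; [apply support_subset; [exact Hos|] | apply rank_le_intro];
      intros z Hz; destruct (Ho z Hz). }
  (* Variables that are not free may denote anything; with a value in [total], they too
     are in the common layer of the values of the first [n] variables. *)
  set (rho1 i := if excluded_middle_informative (free i (fEx psi)) then rho i else o).
  assert (H1 : forall i, free i (fEx psi) -> rho1 i = rho i).
  { intros i Hi. unfold rho1. now destruct (excluded_middle_informative (free i (fEx psi))). }
  destruct (common_layer rho1 n HLne) as (a & Ha & Hia).
  { intros i _. unfold rho1. destruct (excluded_middle_informative (free i (fEx psi))); auto. }
  destruct (HL a Ha) as (b & Hb & Hab & Habs). destruct (HL b Hb) as (c & Hc & Hbc & _).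
  assert (E : forall i, free i (fEx psi) -> prepend n rho1 (fun _ => K) i = rho i).
  { intros i Hi. rewrite prepend_lt; [auto|]. now apply free_fv_bound. }
  assert (Es : forall z, sat (scons z (prepend n rho1 (fun _ => K))) psi <-> sat (scons z rho) psi).
  { intros z. apply sat_free_ext. intros [|i] Hi; cbn; auto. }
  destruct (witnesses_copy psi a b Ha Hb Habs rho1 Hia) as (z & Hz & Hzb).
  { exists y. now apply Es. }
  apply Es in Hz.
  destruct (bounded_witness_moves psi rho a b c z Ha Hb Hc Hab Hbc) as (y' & Hy' & Hsat); auto.
  - intros i Hi. rewrite <- H1 by exact Hi. apply Hia, free_fv_bound, Hi.
  - exists y'. split; [|exact Hsat]. apply mem_total. eauto.
Qed.

End ReflectingSet.

Lemma reflection_of_supported_cardinals p :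
  (forall x, is_set x -> exists c, equinumerous x c /\ subset (support c) (support p)) ->
  reflection_principle M.
Proof.
  intros Hp phi x Hx.
  set (K := cup (support p) (support x)).
  assert (HK : forall u, u ∈ K -> ur u)
    by (intros u Hu; apply mem_cup in Hu; destruct Hu as [Hu|Hu]; exact (support_ur _ u Hu)).
  assert (Hcard : forall x, is_set x -> exists c, equinumerous x c /\ subset (support c) K).
  { intros y Hy. destruct (Hp y Hy) as (c & Hc & Hs). exists c. split; [exact Hc|].
    intros u Hu. apply mem_cup. auto. }
  destruct (closed_chain (fun a b => all_ex (fun psi => absorbs K psi a b) phi) x)
    as (L & HLne & HL).
  - apply (all_ex_Def2 (absorbs K)). apply Def2_absorbs.
  - intros a b b' H Hle. revert H. apply all_ex_impl. intros psi H. now apply absorbs_le with b.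
  - intros a. apply (all_ex_total (absorbs K)); [exact (fun psi => absorbs_le K psi a)|].
    intros psi. now apply absorbs_total.
  - destruct (fresh_copy (stage K L) K) as (A & HA & HAu & HE & Hdis); [apply stage_is_set|].
    destruct (equinumerous_elim _ _ HE) as (F & G & HF & _ & HFG & _).
    assert (HFA : forall z, z ∈ stage K L -> ur (F z) /\ ~ F z ∈ K)
      by (intros z Hz; destruct (HFG z Hz); auto).
    assert (HFinj : forall z z', z ∈ stage K L -> z' ∈ stage K L -> F z = F z' -> z = z').
    { intros z z' Hz Hz' E. destruct (HFG z Hz) as [_ E1], (HFG z' Hz') as [_ E2].
      now rewrite <- E1, E, E2. }
    assert (HLrank : forall a, a ∈ L -> exists y, a = rank y) by (intros a Ha; now apply HL).
    eexists. split; [|split].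
    + apply (total_transitive K L F HF).
    + destruct HLne as [a Ha]. intros z Hz.
      refine (proj2 (total_transitive K L F HF) x _ z Hz).
      apply mem_total; [exact HF|]. exists a. split; [exact Ha|]. apply mem_stage.
      split; [|now apply HL]. intros u Hu. apply mem_cup. left. apply mem_cup. now right.
    + intros rho Hrho. eapply reflects_of_witnesses; [|reflexivity|reflexivity|exact Hrho].
      assert (Hall : all_ex (fun psi => forall a, a ∈ L ->
        exists b, b ∈ L /\ rank_lt a b /\ absorbs K psi a b) phi).
      { assert (H : forall a, a ∈ L -> exists b, b ∈ L /\ rank_lt a b
          /\ all_ex (fun psi => absorbs K psi a b) phi) by (intros a Ha; now apply HL).
        clear - H. induction phi; cbn in *; auto.
        - split; [apply IHphi1 | apply IHphi2]; intros a Ha;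
            destruct (H a Ha) as (b & Hb & Hab & H1 & H2); eauto.
        - split; [|apply IHphi]; intros a Ha;
            destruct (H a Ha) as (b & Hb & Hab & H1 & H2); eauto. }
      revert Hall. apply all_ex_impl. intros psi Hpsi.
      apply (total_has_witnesses K L F); try assumption. apply cup_is_set.
Qed.

End SetTheory.

Theorem theorem2 (M : structure) (hZFU : ZFU M)
  (hcard : cardinality_parametrically_representable M)
  (hplen : plenitude_plus M) :
  reflection_principle M.
Proof.
  destruct (equinumerous_supported hZFU hplen hcard) as [p Hp].
  exact (reflection_of_supported_cardinals hZFU hplen p Hp).
Qed.
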